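(* Let $k$ be a field and let $Q$ be a finite quiver without loops. (1) There exists an admissible ideal $I$ of $kQ$ such that $\operatorname{gldim}(kQ/I)\leq 2$. (2) Let $d,m\in\mathbb{N}$ with $2\leq d<m$. If $A_m$ is a subquiver of $Q$, then there exists an admissible ideal $I'$ of $kQ$ such that $\operatorname{gldim}(kQ/I')=d$. (3) Let $d,m\in\mathbb{N}$ with $2\leq d\leq m$. If $X_m$ is a subquiver of $Q$, then there exists an admissible ideal $I'$ of $kQ$ such that $\operatorname{gldim}(kQ/I')=d$. Moreover, in each of (1), (2), (3) the ideal can be chosen so that it is generated by zero relations of length at most three (i.e. by paths of length at most three) and so that the corresponding algebra $kQ/I$, respectively $kQ/I'$, is strongly quasi-hereditary.
   Context: A finite quiver $Q=(Q_0,Q_1,s,t)$ has finite vertex set $Q_0$, finite arrow set $Q_1$ and maps $s,t\colon Q_1\to Q_0$ giving start and terminal point of each arrow (multiple arrows and oriented cycles are allowed); a loop is an arrow $a$ with $s(a)=t(a)$. The path algebra $kQ$ has the oriented paths (including a path $e_i$ of length zero for each vertex $i$) as $k$-basis, a path of length $n\ge 1$ being written $a_1\cdots a_n$ with $t(a_{i+1})=s(a_i)$ (so $a_n$ is traversed first); the product of paths is concatenation when possible and $0$ otherwise. $kQ^+$ is the ideal generated by all arrows. A two-sided ideal $I$ of $kQ$ is admissible if $(kQ^+)^N\subseteq I\subseteq (kQ^+)^2$ for some integer $N>0$. Modules are finite-dimensional left modules, and $\operatorname{gldim}(kQ/I)$ is the supremum of the projective dimensions of all $kQ/I$-modules. $S(i)$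 denotes the simple module at the vertex $i$ and $P(i)$ its projective cover. A quiver $R=(R_0,R_1,s_R,t_R)$ is a subquiver of $Q$ if $R_0\subseteq Q_0$, $R_1\subseteq Q_1$, $s_R=s_Q|_{R_1}$, $t_R=t_Q|_{R_1}$ (for the quivers $A_m$ and $X_m$ this is understood up to renaming vertices and arrows, i.e. $Q$ has a subquiver isomorphic to the given one). For $m\in\mathbb{N}_{>0}$, $A_m$ is the quiver $1\to 2\to\cdots\to m-1\to m$ with $m$ distinct vertices, and $X_m$ is a quiver consisting of $1\to 2\to\cdots\to m$ (with $m$ distinct vertices) together with one additional arrow $m\to i$ for some $1\leq i<m$. Strongly quasi-hereditary: let $Q_0$ be labelled as $\{1,2,\dots,n\}$ and $I$ admissible. Then $kQ/I$ is strongly quasi-hereditary (with respect to this labelling) if for every $i\in Q_0$ there is an exact sequence $0\to R(i)\to P(i)\to\Delta(i)\to 0$ such that (a) $R(i)$ is a (possibly zero) direct sum of projective modules $P(j)$ with $j<i$, and (b) if $S(j)$ is a composition factor of $\operatorname{rad}(\Delta(i))$, then $j>i$. For a quiver whose vertices are not already labelled, strongly quasi-hereditary means that this holds for some labelling of the vertices by $1,\dots,n$. *)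

(* Defs.v *)
From HB Require Import structures.
From mathcomp Require Import all_boot all_algebra.
From mathcomp Require Import generic_quotient finmap monalg.
From mathcomp Require Import boolp classical_sets.

Set Implicit Arguments.
Unset Strict Implicit.
Unset Printing Implicit Defensive.

Import GRing.Theory.
Local Open Scope ring_scope.
Local Open Scope classical_set_scope.
Local Open Scope quotient_scope.

(* A k-algebra is a ring with a central structure map [kmap : k -> A].
   MathComp's [algType] imposes [1 != 0], which fails for the path algebra of
   the empty quiver. *)
HB.mixin Record hasScalars (k : pzRingType) A of GRing.PzRing A := {
  kmap : k -> A;
  kmap1 : kmap 1 = 1;
  kmapB : forall c d, kmap (c - d) = kmap c - kmap d;
  kmapM : forall c d, kmap (c * d) = kmap c * kmap d;
  kmap_central : forall c (x : A), kmap c * x = x * kmap c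
}.

#[short(type="pzAlgType")]
HB.structure Definition PzAlgebra (k : pzRingType) :=
  {A of GRing.PzRing A & hasScalars k A}.

Record ideal (R : pzRingType) := Ideal {
  ideal_set :> set R;
  ideal0 : ideal_set 0;
  idealD : forall x y, ideal_set x -> ideal_set y -> ideal_set (x + y);
  idealMl : forall a x, ideal_set x -> ideal_set (a * x);
  idealMr : forall a x, ideal_set x -> ideal_set (x * a)
}.

Section IdealOperations.
Context {R : pzRingType}.

Definition ideal_gen (S : set R) : set R :=
  [set x | forall J : ideal R, S `<=` J -> ideal_set J x].

Definition ideal_mul (I J : set R) : set R :=
  [set x | exists (n : nat) (a b : 'I_n -> R),
     (forall i, I (a i)) /\ (forall i, J (b i)) /\ x = \sum_i a i * b i].

Fixpoint ideal_exp (I : set R) (n : nat) : set R :=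
  if n is n'.+1 then ideal_mul (ideal_exp I n') I else setT.

End IdealOperations.

Section QuotientAlgebra.
Context {k : pzRingType} {A : pzAlgType k}.
Implicit Type I : ideal A.

Definition ideal_pred I : {pred A} := fun x => `[< ideal_set I x >].

Lemma ideal_predE I x : (x \in ideal_pred I) = `[< ideal_set I x >].
Proof. by []. Qed.

Lemma ideal_pred_zmod I : zmod_closed (ideal_pred I).
Proof.
split=> [|x y]; rewrite !ideal_predE; first exact/asboolP/ideal0.
move=> /asboolP Ix /asboolP Iy; apply/asboolP/idealD => //.
by rewrite -mulN1r; apply: idealMl.
Qed.

HB.instance Definition _ I :=
  GRing.isZmodClosed.Build A (ideal_pred I) (ideal_pred_zmod I).

Definition quot_alg I : Type := Quotient.quot (ideal_pred I).
HB.instance Definition _ I := GRing.Zmodule.on (quot_alg I).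

Definition quot_proj I (x : A) : quot_alg I := \pi_(Quotient.quot (ideal_pred I)) x.
Definition quot_repr I (x : quot_alg I) : A :=
  repr (x : Quotient.quot (ideal_pred I)).

Lemma quot_reprK I : cancel (@quot_repr I) (@quot_proj I).
Proof. exact: reprK. Qed.

Lemma quot_projP I x y : quot_proj I x = quot_proj I y <-> ideal_set I (x - y).
Proof.
split=> [/eqP|Ixy].
  by rewrite /quot_proj -Quotient.idealrBE ideal_predE => /asboolP.
by apply/eqP; rewrite /quot_proj -Quotient.idealrBE ideal_predE; apply/asboolP.
Qed.

Lemma quot_projD I x y : quot_proj I (x + y) = quot_proj I x + quot_proj I y.
Proof. by rewrite /quot_proj [LHS](Quotient.pi_add _ x y). Qed.

Lemma quot_repr_proj I x : ideal_set I (quot_repr (quot_proj I x) - x).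
Proof. by apply/quot_projP; rewrite quot_reprK. Qed.

Definition quot_one I : quot_alg I := quot_proj I 1.
Definition quot_mul I (x y : quot_alg I) : quot_alg I :=
  quot_proj I (quot_repr x * quot_repr y).

Lemma quot_projM I x y :
  quot_mul (quot_proj I x) (quot_proj I y) = quot_proj I (x * y).
Proof.
apply/quot_projP; set x' := quot_repr _; set y' := quot_repr _.
rewrite -(subrKA (x' * y)) -mulrBr -mulrBl.
by apply: idealD; [apply: idealMl|apply: idealMr]; apply: quot_repr_proj.
Qed.

Lemma quot_mulA I : associative (@quot_mul I).
Proof.
move=> x y z; rewrite -(quot_reprK x) -(quot_reprK y) -(quot_reprK z).
by rewrite !quot_projM mulrA.
Qed.
Lemma quot_mul1 I : left_id (quot_one I) (@quot_mul I).
Proof. by move=> x; rewrite -(quot_reprK x) quot_projM mul1r. Qed.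
Lemma quot_mulr1 I : right_id (quot_one I) (@quot_mul I).
Proof. by move=> x; rewrite -(quot_reprK x) quot_projM mulr1. Qed.
Lemma quot_mulDl I : left_distributive (@quot_mul I) +%R.
Proof.
move=> x y z; rewrite -(quot_reprK x) -(quot_reprK y) -(quot_reprK z).
by rewrite -[X in quot_mul X _]quot_projD !quot_projM mulrDl quot_projD.
Qed.
Lemma quot_mulDr I : right_distributive (@quot_mul I) +%R.
Proof.
move=> x y z; rewrite -(quot_reprK x) -(quot_reprK y) -(quot_reprK z).
by rewrite -[X in quot_mul _ X]quot_projD !quot_projM mulrDr quot_projD.
Qed.
HB.instance Definition _ I := GRing.Zmodule_isPzRing.Build (quot_alg I)
  (@quot_mulA I) (@quot_mul1 I) (@quot_mulr1 I) (@quot_mulDl I) (@quot_mulDr I).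

Definition quot_kmap I (c : k) : quot_alg I := quot_proj I (kmap c).
Lemma quot_kmap1 I : quot_kmap I 1 = 1.
Proof. by rewrite /quot_kmap kmap1. Qed.
Lemma quot_kmapB I c d : quot_kmap I (c - d) = quot_kmap I c - quot_kmap I d.
Proof.
apply/eqP; rewrite eq_sym subr_eq; apply/eqP.
by rewrite /quot_kmap -quot_projD kmapB subrK.
Qed.
Lemma quot_kmapM I c d : quot_kmap I (c * d) = quot_kmap I c * quot_kmap I d.
Proof. by rewrite -[RHS]/(quot_mul _ _) quot_projM -kmapM. Qed.
Lemma quot_kmap_central I c (x : quot_alg I) :
  quot_kmap I c * x = x * quot_kmap I c.
Proof.
rewrite -(quot_reprK x) -[LHS]/(quot_mul _ _) -[RHS]/(quot_mul _ _).
by rewrite !quot_projM kmap_central.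
Qed.
HB.instance Definition _ I := hasScalars.Build k (quot_alg I)
  (@quot_kmap1 I) (@quot_kmapB I) (@quot_kmapM I) (@quot_kmap_central I).

End QuotientAlgebra.

Record submodule (A : pzRingType) (M : lmodType A) := Submodule {
  submod_set :> set M;
  submod0 : submod_set 0;
  submodD : forall x y, submod_set x -> submod_set y -> submod_set (x + y);
  submodZ : forall a x, submod_set x -> submod_set (a *: x)
}.

Section SubmoduleType.
Context {A : pzRingType} {M : lmodType A}.
Implicit Type U : submodule M.

Definition submod_pred U : {pred M} := fun x => `[< submod_set U x >].

Lemma submod_pred_closed U : subsemimod_closed (submod_pred U).
Proof.
split; first split.
- by rewrite unfold_in; apply/asboolP/submod0.
- move=> x y; rewrite !unfold_in => /asboolP Ux /asboolP Uy.
  by apply/asboolP/submodD.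
- move=> a x; rewrite !unfold_in => /asboolP Ux.
  by apply/asboolP/submodZ.
Qed.

Record submod_type U : Type :=
  SubmodElt { submod_val : M; _ : submod_pred U submod_val }.
HB.instance Definition _ U := [isSub for @submod_val U].
HB.instance Definition _ U := [Choice of submod_type U by <:].
HB.instance Definition _ U := GRing.SubChoice_isSubLmodule.Build A M
  (submod_pred U) (submod_type U) (submod_pred_closed U).

Definition submod_maximal U :=
  ~ (forall x, submod_set U x) /\
  forall V : submodule M, U `<=` V -> V `<=` U \/ (forall x, submod_set V x).

Definition radical_set : set M :=
  [set x | forall U, submod_maximal U -> submod_set U x].

Lemma radical0 : radical_set 0.
Proof. by move=> U _; apply: submod0. Qed.
Lemma radicalD x y : radical_set x -> radical_set y -> radical_set (x + y).
Proof. by move=> rx ry U mU; apply: submodD; [apply: rx|apply: ry]. Qed.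
Lemma radicalZ a x : radical_set x -> radical_set (a *: x).
Proof. by move=> rx U mU; apply: submodZ; apply: rx. Qed.

Definition radical : submodule M := Submodule radical0 radicalD radicalZ.

End SubmoduleType.

Arguments radical {A} M.

Section Modules.
Context {A : pzRingType}.
Implicit Types M N P S : lmodType A.

Definition surjective (T T' : Type) (f : T -> T') := forall y, exists x, f x = y.

Definition short_exact (M N P : lmodType A)
    (f : {linear M -> N}) (g : {linear N -> P}) :=
  [/\ injective f, surjective g
    & forall y, g y = 0 <-> exists x, y = f x].

Definition simple_module S :=
  (exists x : S, x <> 0) /\
  forall U : submodule S, (forall x, submod_set U x -> x = 0) \/ (forall x, submod_set U x).

Definition projective_module P :=
  forall (M N : lmodType A) (f : {linear M -> N}) (g : {linear P -> N}),
    surjective f -> exists h : {linear P -> M}, forall x, f (h x) = g x.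

(* The third clause says that the kernel of [f] is superfluous. *)
Definition projective_cover P S (f : {linear P -> S}) :=
  [/\ projective_module P, surjective f
    & forall U : submodule P,
        (forall x, exists u v, [/\ submod_set U u, f v = 0 & x = u + v]) ->
        forall x, submod_set U x].

(* The isomorphism of [V/U] with [S] is given as a surjection with kernel [U]. *)
Definition is_factor M (U V : submodule M) S :=
  U `<=` V /\
  exists f : {linear submod_type V -> S},
    surjective f /\ forall x, f x = 0 <-> submod_set U (val x).

Definition composition_series M (r : nat) (F : nat -> submodule M) :=
  [/\ forall x, submod_set (F 0%N) x -> x = 0,
      forall x, submod_set (F r) x
    & forall l, (l < r)%N ->
        exists T : lmodType A, simple_module T /\ is_factor (F l) (F l.+1) T].

Definition composition_factor M S :=
  simple_module S /\
  exists r (F : nat -> submodule M), composition_series r F /\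
    exists2 l, (l < r)%N & is_factor (F l) (F l.+1) S.

(* [M] is isomorphic, via the [iota l], to the external direct sum of the
   [F l], [l < r]; the empty sum is allowed. *)
Definition is_direct_sum M (r : nat) (F : 'I_r -> lmodType A) :=
  exists iota : forall l, {linear F l -> M},
    (forall x, exists y : forall l, F l, x = \sum_l iota l (y l)) /\
    (forall y : forall l, F l,
       \sum_l iota l (y l) = 0 -> forall l, y l = 0).

End Modules.

Section GlobalDimension.
Context {k : fieldType} {A : pzAlgType k}.

Definition fin_dim (M : lmodType A) :=
  exists n (v : 'I_n -> M), forall x, exists c : 'I_n -> k,
    x = \sum_i (kmap (c i) : A) *: v i.

(* Projective resolutions 0 -> P n -> ... -> P 0 -> M -> 0, padded with zero
   modules above degree [n]. *)
Definition projective_resolution (M : lmodType A) (n : nat)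
    (P : nat -> lmodType A) (d : forall i, {linear P i.+1 -> P i})
    (eps : {linear P 0%N -> M}) :=
  [/\ forall i, fin_dim (P i) /\ projective_module (P i),
      forall i (x : P i), (n < i)%N -> x = 0,
      surjective eps,
      forall x, eps x = 0 <-> exists y, x = d 0%N y
    & forall i x, d i x = 0 <-> exists y, x = d i.+1 y].

Definition projdim_le (M : lmodType A) (n : nat) :=
  exists P d eps, @projective_resolution M n P d eps.

Definition gldim_le (n : nat) :=
  forall M : lmodType A, fin_dim M -> projdim_le M n.

(* The supremum may be infinite, so its value is given by a relation: [d] is
   the least upper bound of the projective dimensions. *)
Definition gldim_eq (d : nat) :=
  gldim_le d /\ forall n, gldim_le n -> (d <= n)%N.

End GlobalDimension.

Arguments gldim_le {k} A n.
Arguments gldim_eq {k} A d.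

Record quiver := Quiver {
  vertex : finType;
  arrow : finType;
  src : arrow -> vertex;
  tgt : arrow -> vertex
}.

Definition no_loops (Q : quiver) := forall a : arrow Q, src a <> tgt a.

Definition subquiver (R Q : quiver) :=
  exists (fv : vertex R -> vertex Q) (fa : arrow R -> arrow Q),
    [/\ injective fv, injective fa,
        forall a, src (fa a) = fv (src a)
      & forall a, tgt (fa a) = fv (tgt a)].

Section LinearQuivers.
Variable m : nat.

Lemma lin_src_subproof (a : 'I_m.-1) : (a < m)%N.
Proof. by case: m a => [|n] [i] //= /ltnW. Qed.
Lemma lin_tgt_subproof (a : 'I_m.-1) : (a.+1 < m)%N.
Proof. by case: m a => [|n] [i]. Qed.

Definition lin_src (a : 'I_m.-1) : 'I_m := Ordinal (lin_src_subproof a).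
Definition lin_tgt (a : 'I_m.-1) : 'I_m := Ordinal (lin_tgt_subproof a).

(* The vertices 1, ..., m are numbered from 0. *)
Definition quiverA := Quiver lin_src lin_tgt.

(* The extra arrow is [None]; it runs from the last vertex to the vertex
   [lin_src i], which is any vertex but the last.  The last vertex exists as
   soon as there is an [i : 'I_m.-1]. *)
Lemma last_subproof (i : 'I_m.-1) : (m.-1 < m)%N.
Proof. by case: m i => [|n] []. Qed.

Definition quiverX (i : 'I_m.-1) : quiver :=
  @Quiver 'I_m (option 'I_m.-1)
    (fun a => if a is Some b then lin_src b else Ordinal (last_subproof i))
    (fun a => if a is Some b then lin_tgt b else lin_src i).

End LinearQuivers.

Section Paths.
Context {Q : quiver}.
Local Notation Q0 := (vertex Q).
Local Notation Q1 := (arrow Q).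

(* The pair [(v, [:: a_1; ...; a_n])] stands for the path a_1...a_n with
   t(a_(i+1)) = s(a_i), whose terminal point is [v]; [(v, [::])] is e_v. *)
Fixpoint is_path (v : Q0) (s : seq Q1) : bool :=
  if s is a :: s' then (tgt a == v) && is_path (src a) s' else true.

Definition qpath := {p : Q0 * seq Q1 | is_path p.1 p.2}.

Definition path_arrows (p : qpath) : seq Q1 := (val p).2.
Definition path_tgt (p : qpath) : Q0 := (val p).1.
Definition path_src (p : qpath) : Q0 :=
  last (path_tgt p) [seq src a | a <- path_arrows p].
Definition path_length (p : qpath) : nat := size (path_arrows p).

Definition vertex_path (i : Q0) : qpath :=
  exist (fun p => is_path p.1 p.2) (i, [::]) isT.

Lemma arrow_path_subproof (a : Q1) : is_path (tgt a) [:: a].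
Proof. by rewrite /= eqxx. Qed.
Definition arrow_path (a : Q1) : qpath :=
  exist (fun p => is_path p.1 p.2) (tgt a, [:: a]) (arrow_path_subproof a).

(* Meaningful only when [path_src p = path_tgt q]. *)
Definition path_cat (p q : qpath) : qpath :=
  insubd p (path_tgt p, path_arrows p ++ path_arrows q).

Lemma is_path_cat v s1 s2 : is_path v (s1 ++ s2) =
  is_path v s1 && is_path (last v [seq src a | a <- s1]) s2.
Proof. by elim: s1 v => //= a s1 IH v; rewrite IH andbA. Qed.

Lemma val_path_cat p q : path_src p = path_tgt q ->
  val (path_cat p q) = (path_tgt p, path_arrows p ++ path_arrows q).
Proof.
move=> pq; rewrite /path_cat insubdK // unfold_in /= is_path_cat.
by rewrite [last _ _]pq (valP p) (valP q).
Qed.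

Lemma path_cat_tgt p q : path_src p = path_tgt q ->
  path_tgt (path_cat p q) = path_tgt p.
Proof. by move=> pq; rewrite /path_tgt val_path_cat. Qed.

Lemma path_cat_arrows p q : path_src p = path_tgt q ->
  path_arrows (path_cat p q) = path_arrows p ++ path_arrows q.
Proof. by move=> pq; rewrite /path_arrows val_path_cat. Qed.

Lemma path_cat_src p q : path_src p = path_tgt q ->
  path_src (path_cat p q) = path_src q.
Proof.
move=> pq; rewrite {1}/path_src path_cat_tgt // path_cat_arrows //.
by rewrite map_cat last_cat -/(path_src p) pq.
Qed.

Lemma path_catA p q r : path_src p = path_tgt q -> path_src q = path_tgt r ->
  path_cat p (path_cat q r) = path_cat (path_cat p q) r.
Proof.
move=> pq qr; apply: val_inj.
rewrite !val_path_cat ?path_cat_tgt ?path_cat_src //.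
by rewrite !path_cat_arrows // catA.
Qed.

Lemma path_cat1p p : path_cat (vertex_path (path_tgt p)) p = p.
Proof. by apply: val_inj; rewrite val_path_cat //; case: p => -[]. Qed.

Lemma path_catp1 p : path_cat p (vertex_path (path_src p)) = p.
Proof. by apply: val_inj; rewrite val_path_cat // cats0; case: p => -[]. Qed.

End Paths.

Arguments qpath : clear implicits.

Lemma monalgUZ (K : choiceType) (R : nzRingType) (c : R) (x : K) :
  << c *g x >> = c *: << x >> :> {malg R[K]}.
Proof. by apply/malgP => y; rewrite mcoeffZ !mcoeffU mulrnAr mulr1. Qed.

Definition path_algebra (k : fieldType) (Q : quiver) : Type := {malg k[qpath Q]}.

HB.instance Definition _ (k : fieldType) (Q : quiver) :=
  GRing.Lmodule.copy (path_algebra k Q) {malg k[qpath Q]}.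

(* Locked, because unification otherwise unfolds finitely supported functions. *)
HB.lock Definition path_elt (k : fieldType) (Q : quiver) (p : qpath Q)
  : path_algebra k Q := << p >>.
Canonical path_elt_unlockable := Unlockable path_elt.unlock.
Arguments path_elt {k Q} p.

Definition path_mul (k : fieldType) (Q : quiver) (p q : qpath Q)
  : path_algebra k Q :=
  if path_src p == path_tgt q then path_elt (path_cat p q) else 0.

Definition lin_ext (k : fieldType) (Q : quiver)
    (h : qpath Q -> path_algebra k Q) (f : path_algebra k Q)
  : path_algebra k Q := \sum_(p <- msupp f) f@_p *: h p.

(* The bilinear extension of [path_mul]; locked like [path_elt]. *)
HB.lock Definition kQ_mul (k : fieldType) (Q : quiver) (f g : path_algebra k Q)
  : path_algebra k Q := lin_ext (fun p => lin_ext (path_mul k p) g) f.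
Canonical kQ_mul_unlockable := Unlockable kQ_mul.unlock.
Arguments kQ_mul {k Q} f g.

Section PathAlgebra.
Context {k : fieldType} {Q : quiver}.
Local Notation kQ := (path_algebra k Q).

Implicit Types (h : qpath Q -> kQ) (f g : kQ).

Definition kQ_one : kQ := \sum_(i : vertex Q) path_elt (vertex_path i).

Lemma lin_extEw h (f : kQ) (D : {fset qpath Q}) : (msupp f `<=` D)%fset ->
  lin_ext h f = \sum_(p <- D) f@_p *: h p.
Proof.
move=> sfD; apply: big_fset_incl => // p _ pNf.
by rewrite mcoeff_outdom ?scale0r.
Qed.

Lemma lin_ext_is_linear h : linear (lin_ext h).
Proof.
move=> c f g; set D := (msupp f `|` msupp g)%fset.
rewrite (@lin_extEw h (c *: f + g) D); last first.
  apply: fsubset_trans (msuppD_le _ _) _.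
  by apply: fsetSU; apply: msuppZ_le.
rewrite (@lin_extEw h f D) ?fsubsetUl // (@lin_extEw h g D) ?fsubsetUr //.
rewrite scaler_sumr -big_split /=; apply: eq_bigr => p _.
by rewrite mcoeffD mcoeffZ scalerDl scalerA.
Qed.
HB.instance Definition _ h :=
  GRing.isLinear.Build k kQ kQ _ (lin_ext h) (lin_ext_is_linear h).

Lemma lin_ext_elt h (p : qpath Q) : lin_ext h (path_elt p) = h p.
Proof.
by rewrite unlock (lin_extEw _ msuppU_le) big_seq_fset1 mcoeffUU scale1r.
Qed.

Lemma eq_lin_ext h h' f : h =1 h' -> lin_ext h f = lin_ext h' f.
Proof. by move=> hh'; apply: eq_bigr => p _; rewrite hh'. Qed.

Lemma lin_ext_hD h h' f :
  lin_ext (fun p => h p + h' p) f = lin_ext h f + lin_ext h' f.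
Proof.
rewrite /lin_ext -big_split /=; apply: eq_bigr => p _; exact: scalerDr.
Qed.

Lemma lin_ext_hZ c h f : lin_ext (fun p => c *: h p) f = c *: lin_ext h f.
Proof.
rewrite /lin_ext scaler_sumr; apply: eq_bigr => p _.
by rewrite !scalerA mulrC.
Qed.

Lemma kQ_elt_sum (f : kQ) : f = \sum_(p <- msupp f) f@_p *: path_elt p.
Proof.
by rewrite {1}[f]monalgE; apply: eq_bigr => p _; rewrite unlock monalgUZ.
Qed.

Lemma kQ_ind (K : kQ -> Prop) : (forall p, K (path_elt p)) -> K 0 ->
  (forall c f g, K f -> K g -> K (c *: f + g)) -> forall f, K f.
Proof.
move=> Kp K0 KD f; rewrite [f]kQ_elt_sum.
by elim/big_rec: _ => // p g _ Kg; apply: KD.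
Qed.

Lemma kQ_mulDl : left_distributive (@kQ_mul k Q) +%R.
Proof. by move=> f g h; rewrite unlock linearD. Qed.
Lemma kQ_mulZl c f g : kQ_mul (c *: f) g = c *: kQ_mul f g.
Proof. by rewrite unlock linearZ. Qed.
Lemma kQ_mul0l f : kQ_mul 0 f = 0.
Proof. by rewrite unlock linear0. Qed.
Lemma kQ_mulZr c f g : kQ_mul f (c *: g) = c *: kQ_mul f g.
Proof.
rewrite unlock -lin_ext_hZ; apply: eq_lin_ext => p; exact: linearZ.
Qed.
Lemma kQ_mulDr : right_distributive (@kQ_mul k Q) +%R.
Proof.
move=> f g h; rewrite unlock -lin_ext_hD; apply: eq_lin_ext => p.
exact: linearD.
Qed.
Lemma kQ_mul0r f : kQ_mul f 0 = 0.
Proof. by have := kQ_mulZr 0 f 0; rewrite !scale0r. Qed.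
Lemma kQ_mul_elt (p q : qpath Q) :
  kQ_mul (path_elt p) (path_elt q) = path_mul k p q.
Proof. by rewrite unlock !lin_ext_elt. Qed.

Lemma kQ_mulA : associative (@kQ_mul k Q).
Proof.
move=> f g h; elim/kQ_ind: f => [p||c f f' IH IH'].
- elim/kQ_ind: g => [q||c g g' IH IH'].
  + elim/kQ_ind: h => [r||c h h' IH IH'].
    * rewrite (kQ_mul_elt q r) (kQ_mul_elt p q) /path_mul.
      case: (eqVneq (path_src q) (path_tgt r)) => qr;
        case: (eqVneq (path_src p) (path_tgt q)) => pq.
      - rewrite (kQ_mul_elt p) (kQ_mul_elt _ r) /path_mul.
        by rewrite path_cat_tgt // path_cat_src // pq qr !eqxx path_catA.
      - rewrite kQ_mul0l (kQ_mul_elt p) /path_mul path_cat_tgt //.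
        by rewrite (negPf pq).
      - rewrite kQ_mul0r (kQ_mul_elt _ r) /path_mul path_cat_src //.
        by rewrite (negPf qr).
      - by rewrite kQ_mul0r kQ_mul0l.
    * by rewrite !kQ_mul0r.
    * by rewrite !(kQ_mulDr, kQ_mulZr) IH IH'.
  + by rewrite !(kQ_mul0l, kQ_mul0r).
  + by rewrite !(kQ_mulDr, kQ_mulZr, kQ_mulDl, kQ_mulZl) IH IH'.
- by rewrite !kQ_mul0l.
- by rewrite !(kQ_mulDl, kQ_mulZl) IH IH'.
Qed.

Lemma kQ_suml (s : seq (vertex Q)) F g :
  kQ_mul (\sum_(i <- s) F i) g = \sum_(i <- s) kQ_mul (F i) g.
Proof.
by elim/big_rec2: _ => [|i x y _ <-]; rewrite ?kQ_mul0l ?kQ_mulDl.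
Qed.
Lemma kQ_sumr (s : seq (vertex Q)) F g :
  kQ_mul g (\sum_(i <- s) F i) = \sum_(i <- s) kQ_mul g (F i).
Proof.
by elim/big_rec2: _ => [|i x y _ <-]; rewrite ?kQ_mul0r ?kQ_mulDr.
Qed.

Lemma kQ_mul1l : left_id kQ_one (@kQ_mul k Q).
Proof.
elim/kQ_ind => [p||c f g IH IH']; rewrite ?kQ_mul0r //.
- rewrite kQ_suml (bigD1 (path_tgt p)) //= big1 => [|i ip].
    by rewrite addr0 kQ_mul_elt /path_mul eqxx path_cat1p.
  by rewrite kQ_mul_elt /path_mul (negPf ip).
- by rewrite kQ_mulDr kQ_mulZr IH IH'.
Qed.
Lemma kQ_mul1r : right_id kQ_one (@kQ_mul k Q).
Proof.
elim/kQ_ind => [p||c f g IH IH']; rewrite ?kQ_mul0l //.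
- rewrite kQ_sumr (bigD1 (path_src p)) //= big1 => [|i ip].
    by rewrite addr0 kQ_mul_elt /path_mul eqxx path_catp1.
  by rewrite kQ_mul_elt /path_mul eq_sym (negPf ip).
- by rewrite kQ_mulDl kQ_mulZl IH IH'.
Qed.

HB.instance Definition _ := GRing.Zmodule_isPzRing.Build kQ
  kQ_mulA kQ_mul1l kQ_mul1r kQ_mulDl kQ_mulDr.

Definition kQ_kmap (c : k) : kQ := c *: (1 : kQ).
Lemma kQ_kmap1 : kQ_kmap 1 = 1.
Proof. exact: scale1r. Qed.
Lemma kQ_kmapB c d : kQ_kmap (c - d) = kQ_kmap c - kQ_kmap d.
Proof. exact: scalerBl. Qed.
Lemma kQ_kmapM c d : kQ_kmap (c * d) = kQ_kmap c * kQ_kmap d.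
Proof. by rewrite -[RHS]/(kQ_mul _ _) kQ_mulZl kQ_mul1l /kQ_kmap scalerA. Qed.
Lemma kQ_kmap_central c (f : kQ) : kQ_kmap c * f = f * kQ_kmap c.
Proof.
rewrite -[LHS]/(kQ_mul _ _) -[RHS]/(kQ_mul _ _) kQ_mulZl kQ_mulZr.
by rewrite kQ_mul1l kQ_mul1r.
Qed.
HB.instance Definition _ := hasScalars.Build k kQ
  kQ_kmap1 kQ_kmapB kQ_kmapM kQ_kmap_central.

Definition arrow_ideal : set kQ :=
  ideal_gen [set f | exists a, f = path_elt (arrow_path a)].

Definition admissible (I : ideal kQ) :=
  (exists2 N, (0 < N)%N & ideal_exp arrow_ideal N `<=` I) /\
  I `<=` ideal_exp arrow_ideal 2.

Definition gen_by_paths_le (l : nat) (I : ideal kQ) :=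
  exists2 Z : set (qpath Q), (forall p, Z p -> (path_length p <= l)%N)
    & I `<=>` ideal_gen [set f | exists2 p, Z p & f = path_elt p].

End PathAlgebra.

Section StronglyQuasiHereditary.
Context {k : fieldType} {Q : quiver} (I : ideal (path_algebra k Q)).
Local Notation A := (quot_alg I).

Definition path_class (p : qpath Q) : A := quot_proj I (path_elt p).

(* [S] is S(i): one-dimensional, with e_i acting as the identity (hence e_j as
   0 for j <> i) and every arrow acting as 0. *)
Definition is_simple_at (i : vertex Q) (S : lmodType A) :=
  exists v : S,
    [/\ v <> 0,
        forall x, exists c : k, x = (kmap c : A) *: v,
        path_class (vertex_path i) *: v = v
      & forall a, path_class (arrow_path a) *: v = 0].

(* [P] is P(i), a projective cover of S(i). *)
Definition is_projective_at (i : vertex Q) (P : lmodType A) :=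
  fin_dim P /\
  exists (S : lmodType A) (f : {linear P -> S}),
    is_simple_at i S /\ projective_cover f.

(* The labels 1, ..., n are shifted to 0, ..., n - 1; only their order
   matters. *)
Definition strongly_quasi_hereditary_for (lab : vertex Q -> 'I_#|vertex Q|) :=
  forall i, exists (R P Delta : lmodType A)
      (f : {linear R -> P}) (g : {linear P -> Delta}),
    [/\ is_projective_at i P,
        short_exact f g,
        exists r (js : 'I_r -> vertex Q) (F : 'I_r -> lmodType A),
          (forall l, (lab (js l) < lab i)%N /\ is_projective_at (js l) (F l)) /\
          is_direct_sum R F
      & forall j (S : lmodType A), is_simple_at j S ->
          composition_factor (submod_type (radical Delta)) S ->
          (lab i < lab j)%N].

Definition strongly_quasi_hereditary :=
  exists2 lab, bijective lab & strongly_quasi_hereditary_for lab.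

End StronglyQuasiHereditary.

(* Main.v *)
From HB Require Import structures.
Require Import Defs.
From mathcomp Require Import all_boot all_algebra.
From mathcomp Require Import generic_quotient monalg.
From mathcomp Require Import boolp classical_sets.

Set Implicit Arguments.
Unset Strict Implicit.
Unset Printing Implicit Defensive.

Import GRing.Theory.

(** Label the vertices by 1, ..., n.  As there are no loops, every arrow goes up
    or goes down with respect to the labels.  Divide the path algebra by the
    paths of length two which go up and then down, and by some chosen paths of
    length two which go up twice.  All of the claims concern such quotients A.

    The surviving (normal) paths go down first and then up, hence are bounded
    in length; so the ideal is admissible (mon_ideal_admissible).

    A is strongly quasi-hereditary (label_sqh).  No relation starts with an
    arrow going down, so right multiplication by such an arrow x_a, from i to
    j, maps P(j) = A e_j isomorphically onto A x_a.  The sum R(i) of these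
    A x_a is direct, and P(i) / R(i) has as basis the paths from i which go up
    all the way; they end at vertices with a larger label.

    The global dimension of a finite-dimensional quadratic monomial algebra is
    the length of its longest relation chain, that is, of the longest sequence
    of arrows c_1, ..., c_l in which each pair of neighbours is a relation.
    - Upper bound (gldim_le_relation_chains).  Quadratic monomial algebras are
      Koszul: every module M has a resolution with P_l the sum over the chains
      of length l of the modules A e_(t c_l) tensor e_(s c_1) M, so that P_l
      vanishes when there is no such chain.
    - Lower bound (gldim_ge_relation_chain, for chains of length at least two).
      A x_(c_1) is a direct summand of the radical of P(s c_1), the syzygy of a
      simple module.  If (a, b) is a relation, the kernel of A e_(t a) -> A x_a
      has A x_b as a direct summand, and A x_a is not projective.  Following
      the chain, the simple module at s(c_1) has projective dimension at least
      l.

    Without chosen relations, a chain consists of at most one arrow going up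
    and one arrow going down; this gives (1).  For (2) and (3), both A_m with
    d < m and X_m with d <= m contain d distinct vertices v_0, ..., v_(d-1),
    arrows between consecutive ones, and one more arrow c leaving v_(d-1).
    Give these vertices the d largest labels, in this order.  The d - 1 arrows
    then go up, and c goes down, as it is not a loop.  Choose as relations the
    pairs of consecutive arrows among the d - 1; then these arrows and c form a
    longest chain, of length d (chain_ideal). *)

(** * Submodules and quotients *)
Section ModuleConstructions.
Local Open Scope ring_scope.
Context {A : pzRingType}.
Implicit Types M N P : lmodType A.

Definition linear_of M N (f : M -> N) (fL : linear f) : {linear M -> N} :=
  HB.pack f (GRing.isLinear.Build A M N _ f fL).

Lemma linear_ofE M N (f : M -> N) (fL : linear f) : linear_of fL =1 f.
Proof. by []. Qed.

Definition submod_incl M (U : submodule M) : {linear submod_type U -> M} := \val.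

Lemma submod_valP M (U : submodule M) (x : submod_type U) : submod_set U (val x).
Proof. by have /asboolP := valP x. Qed.

Definition submod_elt M (U : submodule M) x (Ux : submod_set U x) : submod_type U :=
  @SubmodElt A M U x (asboolT Ux).

Section Corestriction.
Variables (M N : lmodType A) (V : submodule N) (f : {linear M -> N}).
Hypothesis fV : forall x, submod_set V (f x).
Let g x := submod_elt (fV x).
Lemma corestrict_subproof : linear g.
Proof. by move=> a x y; apply: val_inj; rewrite linearP /= linearP. Qed.
Definition corestrict : {linear M -> submod_type V} := linear_of corestrict_subproof.
End Corestriction.

Lemma lin_kernel_subproof M N (f : {linear M -> N}) :
  [/\ f 0 = 0, forall x y, f x = 0 -> f y = 0 -> f (x + y) = 0
    & forall a x, f x = 0 -> f (a *: x) = 0].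
Proof.
split=> [|x y fx fy|a x fx]; rewrite ?linear0 // ?linearD ?linearZ /=.
  by rewrite fx fy addr0.
by rewrite fx scaler0.
Qed.

Definition lin_kernel M N (f : {linear M -> N}) : submodule M :=
  let: And3 f0 fD fZ := lin_kernel_subproof f in
  @Submodule A M [set x | f x = 0]%classic f0 fD fZ.

Lemma lin_kernelP M N (f : {linear M -> N}) x : submod_set (lin_kernel f) x <-> f x = 0.
Proof. by rewrite /lin_kernel; case: lin_kernel_subproof. Qed.

End ModuleConstructions.

Section QuotientModule.
Local Open Scope ring_scope.
Local Open Scope quotient_scope.
Context {A : pzRingType} {M : lmodType A}.
Variable U : submodule M.

Lemma submod_pred_zmod : zmod_closed (submod_pred U).
Proof.
split=> [|x y]; rewrite !unfold_in; first exact/asboolP/submod0.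
move=> /asboolP Ux /asboolP Uy; apply/asboolP/submodD => //.
by rewrite -scaleN1r; apply: submodZ.
Qed.
HB.instance Definition _ := GRing.isZmodClosed.Build M (submod_pred U) submod_pred_zmod.

Definition quot_mod : Type := Quotient.quot (submod_pred U).
HB.instance Definition _ := GRing.Zmodule.on quot_mod.

Definition qclass (x : M) : quot_mod := \pi_(Quotient.quot (submod_pred U)) x.
Definition qrepr (x : quot_mod) : M := repr (x : Quotient.quot (submod_pred U)).

Lemma qreprK : cancel qrepr qclass. Proof. exact: reprK. Qed.

Lemma qclassP x y : qclass x = qclass y <-> submod_set U (x - y).
Proof.
split=> [/eqP|Uxy].
  by rewrite /qclass -Quotient.idealrBE unfold_in => /asboolP.
by apply/eqP; rewrite /qclass -Quotient.idealrBE unfold_in; apply/asboolP.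
Qed.

Lemma qclassD x y : qclass (x + y) = qclass x + qclass y.
Proof. by rewrite /qclass [LHS](Quotient.pi_add _ x y). Qed.

Definition qscale a (x : quot_mod) : quot_mod := qclass (a *: qrepr x).
Lemma qclassZ_subproof a x : qscale a (qclass x) = qclass (a *: x).
Proof. by apply/qclassP; rewrite -scalerBr; apply: submodZ; apply/qclassP/qreprK. Qed.

Lemma qscaleA a b x : qscale a (qscale b x) = qscale (a * b) x.
Proof. by rewrite -[x]qreprK !qclassZ_subproof scalerA. Qed.
Lemma qscale1 : left_id 1 qscale.
Proof. by move=> x; rewrite -[x]qreprK qclassZ_subproof scale1r. Qed.
Lemma qscaleDr : right_distributive qscale +%R.
Proof.
move=> a x y; rewrite -[x]qreprK -[y]qreprK -qclassD !qclassZ_subproof.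
by rewrite -qclassD scalerDr.
Qed.
Lemma qscaleDl x : {morph qscale^~ x : a b / a + b}.
Proof.
by move=> a b /=; rewrite -[x]qreprK !qclassZ_subproof -qclassD scalerDl.
Qed.
HB.instance Definition _ :=
  GRing.Zmodule_isLmodule.Build A quot_mod qscaleA qscale1 qscaleDr qscaleDl.

Lemma qclass_linear : linear qclass.
Proof. by move=> a x y; rewrite qclassD -qclassZ_subproof. Qed.

Definition quot_map : {linear M -> quot_mod} := linear_of qclass_linear.

Lemma quot_map_surj : surjective quot_map.
Proof. by move=> y; exists (qrepr y); apply: qreprK. Qed.

Lemma quot_mapP x : quot_map x = 0 <-> submod_set U x.
Proof. by rewrite -(linear0 quot_map) -{2}[x]subr0; apply: qclassP. Qed.

End QuotientModule.

(** * Projective modules and projective dimension *)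
Section Projectives.
Local Open Scope ring_scope.
Context {A : pzRingType}.
Implicit Types M N P K Q S : lmodType A.

Lemma retract_projective P K (i : {linear K -> P}) (r : {linear P -> K}) :
  (forall x, r (i x) = x) -> projective_module P -> projective_module K.
Proof.
move=> ri projP M N f g fS.
have [h hE] := projP M N f (g \o r) fS.
by exists (h \o i) => x; rewrite /= hE /= ri.
Qed.

Lemma pair_projective P Q :
  projective_module P -> projective_module Q -> projective_module (P * Q)%type.
Proof.
move=> pP pQ M N f g fS.
have inlL : linear (fun x : P => (x, 0) : P * Q).
  by move=> a x y; congr pair; rewrite /= scaler0 addr0.
have inrL : linear (fun x : Q => (0, x) : P * Q).
  by move=> a x y; congr pair; rewrite /= scaler0 addr0.
have [h hE] := pP M N f (g \o linear_of inlL) fS.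
have [h' hE'] := pQ M N f (g \o linear_of inrL) fS.
have kL : linear (fun x : P * Q => h x.1 + h' x.2).
  by move=> a x y; rewrite /= !linearP /= scalerDr addrACA.
exists (linear_of kL) => -[x y]; rewrite linear_ofE linearD hE hE' /= -linearD.
by congr (g _); congr pair; rewrite /= ?addr0 ?add0r.
Qed.

(** Projective dimension at most [n].  Arbitrary projective modules are allowed in
    the resolution, because the comparison of syzygies adds projective summands of
    any size. *)
Fixpoint pd_le n M : Prop :=
  if n is n'.+1 then
    exists P K (i : {linear K -> P}) (f : {linear P -> M}),
      [/\ projective_module P, short_exact i f & pd_le n' K]
  else projective_module M.

(** [K] is a direct summand of [K'] up to a projective module.  Schanuel's lemma
    takes a simple form for this relation: it passes to syzygies. *)
Definition stable_retract K K' := exists P (i : {linear K -> (K' * P)%type})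
  (r : {linear (K' * P)%type -> K}),
  projective_module P /\ forall x, r (i x) = x.

(** The map [i] is a kernel of [f]. *)
Lemma short_exact_factor K P M N (i : {linear K -> P}) (f : {linear P -> M})
    (g : {linear N -> P}) :
  short_exact i f -> (forall x, f (g x) = 0) ->
  exists h : {linear N -> K}, forall x, i (h x) = g x.
Proof.
case=> iI fS ex fg0.
have [x|h hE] := @choice _ _ (fun x y => i y = g x).
  by have [y] := (ex (g x)).1 (fg0 x); exists y.
have hL : linear h.
  by move=> a x y; apply: iI; rewrite linearP !hE linearP.
by exists (linear_of hL).
Qed.

Lemma lin_kernel_short_exact M N (f : {linear M -> N}) :
  surjective f -> short_exact (submod_incl (lin_kernel f)) f.
Proof.
move=> fS; split=> // [|y]; first exact: val_inj.
split=> [fy|[x ->]]; last exact/lin_kernelP/submod_valP.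
by exists (submod_elt ((lin_kernelP f y).2 fy)).
Qed.

(** Lift the inclusion [j] of [M] and the retraction [r] to maps [jt] and [rt]
    between the projective covers.  The composite [rt \o jt] need not be the
    identity of [P], but it is modulo [K]; the extra summand [P] of the target
    serves to subtract the difference. *)
Lemma stable_retract_syzygy M M' P P' K K'
    (i : {linear K -> P}) (f : {linear P -> M})
    (i' : {linear K' -> P'}) (f' : {linear P' -> M'}) :
  projective_module P -> projective_module P' ->
  short_exact i f -> short_exact i' f' ->
  stable_retract M M' -> stable_retract K K'.
Proof.
move=> pP pP' se se' [Q [j [r [pQ jr]]]].
have [iI fS ex] := se; have [iI' fS' ex'] := se'.
have fQL : linear (fun x : P' * Q => (f' x.1, x.2) : M' * Q).
  by move=> a x y; rewrite /= linearP.
have fQS : surjective (linear_of fQL).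
  by case=> y q; have [x <-] := fS' y; exists (x, q).
have [jt jtE] := pP _ _ _ (j \o f) fQS.
have [rt rtE] := pair_projective pP' pQ (r \o linear_of fQL) fS.
have uL : linear (fun x => (jt (i x)).1) by move=> a x y; rewrite !linearP.
have jt2 x : (jt (i x)).2 = 0.
  by have /(congr1 snd)/= -> := jtE (i x); rewrite (ex (i x)).2 ?linear0 //; exists x.
have [u uE] : exists u : {linear K -> K'}, forall x, i' (u x) = (jt (i x)).1.
  apply: (short_exact_factor (g := linear_of uL) se') => x /=.
  have /(congr1 fst)/= -> := jtE (i x).
  by rewrite (ex (i x)).2 ?linear0 //; exists x.
have vL : linear (fun y : K' * P => rt (i' y.1, 0) - (rt (jt y.2) - y.2)).
  move=> a [y p] [y' p'] /=; rewrite !linearP.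
  have -> : (a *: i' y + i' y', 0 : Q) = a *: (i' y, 0) + (i' y', 0).
    by congr pair; rewrite /= scaler0 addr0.
  rewrite !linearP /= !scalerBr [RHS]addrACA -opprD; congr (_ - _).
  by rewrite [RHS]addrACA scalerN.
have [v vE] : exists v : {linear (K' * P)%type -> K},
    forall y, i (v y) = rt (i' y.1, 0) - (rt (jt y.2) - y.2).
  apply: (short_exact_factor (g := linear_of vL) se) => -[y p] /=.
  have fi y' : f' (i' y') = 0 by apply/ex'; exists y'.
  have jtE' x : (f' (jt x).1, (jt x).2) = j (f x) by apply: jtE.
  rewrite !linearB /= !rtE /= fi jtE' jr subrr addr0.
  exact: (linear0 r).
(* The map [x |-> (jt x, x)] has the retraction [(y, p) |-> rt y - (rt (jt p) - p)]. *)
have wL : linear (fun x => (u x, i x) : K' * P) by move=> a x y; rewrite !linearP.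
exists P, (linear_of wL), v; split=> // x; apply: iI.
rewrite vE /= uE -[X in (_, X)](jt2 x) -surjective_pairing.
by rewrite opprB addrC subrK.
Qed.

Lemma pd_le_stable_retract n M M' :
  stable_retract M M' -> pd_le n M' -> pd_le n M.
Proof.
elim: n M M' => [|n IH] M M' MM'.
  case: MM' => Q [j [r [pQ jr]]] pM'.
  exact: retract_projective jr (pair_projective pM' pQ).
case=> P' [K' [i' [f' [pP' se' pdK']]]].
have [Q [j [r [pQ jr]]]] := MM'; have [_ fS' _] := se'.
have gL : linear (fun x : P' * Q => r (f' x.1, x.2)).
  move=> a x y; rewrite -linearP; congr (r _); congr pair.
  by rewrite /= linearP.
have gS : surjective (linear_of gL).
  move=> m; have [x fx] := fS' (j m).1; exists (x, (j m).2).
  by rewrite linear_ofE /= fx -surjective_pairing jr.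
have pPQ := pair_projective pP' pQ.
exists (P' * Q)%type, (submod_type (lin_kernel (linear_of gL))).
exists (submod_incl _), (linear_of gL).
have se := lin_kernel_short_exact gS.
split=> //; apply: IH pdK'.
exact: stable_retract_syzygy se se' MM'.
Qed.

Lemma retract_stable_retract K K' (i : {linear K -> K'}) (r : {linear K' -> K}) :
  (forall x, r (i x) = x) -> stable_retract K K'.
Proof.
move=> ri.
have iL : linear (fun x => (i x, 0) : K' * A^o).
  by move=> a x y; congr pair; rewrite /= ?linearP // scaler0 addr0.
have rL : linear (fun x : K' * A^o => r x.1) by move=> a x y; rewrite linearP.
exists A^o, (linear_of iL), (linear_of rL); split=> //.
move=> X Y f g fS; have [x fx] := fS (g 1).
have hL : linear (fun a : A^o => a *: x).
  by move=> a b c; rewrite scalerDl scalerA.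
exists (linear_of hL) => a; rewrite /= linearZ /= fx -linearZ /=; congr (g _).
exact: mulr1.
Qed.

(** Any projective presentation of [M] computes its projective dimension. *)
Lemma pd_le_syzygy n M P K (i : {linear K -> P}) (f : {linear P -> M}) :
  projective_module P -> short_exact i f -> pd_le n.+1 M -> pd_le n K.
Proof.
move=> pP se [P' [K' [i' [f' [pP' se' pdK']]]]].
apply: pd_le_stable_retract pdK'; apply: stable_retract_syzygy se se' _ => //.
exact: (@retract_stable_retract M M idfun idfun).
Qed.

Lemma pd_leS n M : pd_le n M -> pd_le n.+1 M.
Proof.
elim: n M => [|n IH] M.
  move=> pM; have zS : surjective (idfun : {linear M -> M}) by move=> x; exists x.
  exists M, (submod_type (lin_kernel (idfun : {linear M -> M}))).
  exists (submod_incl _), idfun; split=> //; first exact: lin_kernel_short_exact.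
  move=> X Y f g fS.
  have zL : linear (fun x : submod_type (lin_kernel (idfun : {linear M -> M})) => 0 : X).
    by move=> a x y; rewrite scaler0 addr0.
  exists (linear_of zL) => x; rewrite /= linear0.
  have -> : x = 0 by apply: val_inj; have /lin_kernelP := submod_valP x.
  by rewrite linear0.
by case=> P [K [i [f [pP se pdK]]]]; exists P, K, i, f; split=> //; apply: IH.
Qed.

End Projectives.

Section MoreModules.
Local Open Scope ring_scope.
Context {A : pzRingType}.
Implicit Types M N P K : lmodType A.

(** The easy half of the dual basis lemma. *)
Lemma dual_basis_projective P (X : finType) (g : X -> P) (phi : X -> {linear P -> A^o}) :
  (forall y, y = \sum_x (phi x y : A) *: g x) -> projective_module P.
Proof.
move=> gphi M N f h fS.
have [x|m mE] := @choice _ _ (fun x y => f y = h (g x)); first exact: fS.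
have lL : linear (fun y => \sum_x (phi x y : A) *: m x).
  move=> a y z; rewrite scaler_sumr -big_split; apply: eq_bigr => x _.
  by rewrite linearP scalerDl scalerA.
exists (linear_of lL) => y; rewrite linear_ofE linear_sum [in RHS](gphi y) linear_sum.
by apply: eq_bigr => x _; rewrite !linearZ /= mE.
Qed.

Lemma linear_lift K N M (j : {linear K -> M}) (f : {linear N -> M}) :
  injective j -> (forall x, exists y, j y = f x) ->
  exists h : {linear N -> K}, forall x, j (h x) = f x.
Proof.
move=> jI jf; have [//|h hE] := @choice _ _ (fun x y => j y = f x).
have hL : linear h by move=> a x y; apply: jI; rewrite linearP !hE linearP.
by exists (linear_of hL).
Qed.

Section SubmoduleIn.
Variables (M : lmodType A) (U V : submodule M).
Let S : set (submod_type V) := [set x | submod_set U (val x)]%classic.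
Lemma submod_in0 : S 0. Proof. exact: submod0. Qed.
Lemma submod_inD x y : S x -> S y -> S (x + y). Proof. exact: submodD. Qed.
Lemma submod_inZ a x : S x -> S (a *: x). Proof. exact: submodZ. Qed.
(** The intersection of [U] and [V], as a submodule of [V]. *)
Definition submod_in := Submodule submod_in0 submod_inD submod_inZ.
End SubmoduleIn.

Lemma quot_short_exact M (U : submodule M) : short_exact (submod_incl U) (quot_map U).
Proof.
split=> [x y /val_inj //||y]; first exact: quot_map_surj.
rewrite quot_mapP; split=> [Uy|[x ->]]; last exact: submod_valP.
by exists (submod_elt Uy).
Qed.

End MoreModules.

Section ProjdimPd.
Local Open Scope ring_scope.
Context {k : fieldType} {A : pzAlgType k}.
Implicit Types M N P : lmodType A.

Lemma projdim_le_pd_le M n : projdim_le M n -> pd_le n M.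
Proof.
elim: n M => [|n IH] M [P [d [eps [pP Pz epsS ex0 ex]]]].
  have epsI x : eps x = 0 -> x = 0.
    by move=> /ex0[y ->]; rewrite (Pz 1%N y) ?linear0.
  have [x|h hE] := @choice _ _ (fun x y => eps y = x); first exact: epsS.
  have hL : linear h.
    move=> a x y; apply/eqP; rewrite -subr_eq0; apply/eqP/epsI.
    by rewrite linearB linearP !hE subrr.
  by apply: (@retract_projective _ (P 0%N) M (linear_of hL) eps); case: (pP 0%N).
have dK x : submod_set (lin_kernel eps) (d 0%N x).
  by apply/lin_kernelP/ex0; exists x.
exists (P 0%N), (submod_type (lin_kernel eps)), (submod_incl _), eps.
split; [by case: (pP 0%N)|exact: lin_kernel_short_exact|apply: IH].
exists (fun i => P i.+1), (fun i => d i.+1), (corestrict dK).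
split=> // [i x ni|[x Kx]|x].
- exact: Pz.
- have /asboolP/lin_kernelP/ex0[y yE] := Kx.
  by exists y; apply: val_inj.
- rewrite -ex; split=> [/(congr1 val)//|dx]; exact: val_inj.
Qed.

Lemma fin_dim_surj M N (f : {linear M -> N}) :
  surjective f -> fin_dim M -> fin_dim N.
Proof.
move=> fS [n [v vE]]; exists n, (fun i => f (v i)) => y.
have [x <-] := fS y; have [c ->] := vE x; exists c.
by rewrite linear_sum; apply: eq_bigr => i _; rewrite linearZ.
Qed.

Lemma fin_dim_span M (T : finType) (v : T -> M) :
  (forall x, exists c : T -> k, x = \sum_t (kmap (c t) : A) *: v t) -> fin_dim M.
Proof.
move=> vE; exists #|T|, (v \o enum_val) => x; have [c ->] := vE x.
by exists (c \o enum_val); rewrite (reindex _ (onW_bij _ (@enum_val_bij T))).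
Qed.

Lemma fin_dim_generated M (X : finType) (g : X -> M) :
  fin_dim (A^o : lmodType A) ->
  (forall y, exists phi : X -> A, y = \sum_x phi x *: g x) -> fin_dim M.
Proof.
move=> [n [v vE]] gE; pose w (t : X * 'I_n) := (v t.2 : A) *: g t.1.
apply: (@fin_dim_span _ _ w) => y; have [phi ->] := gE y.
have [x|c cE] := @choice _ _ (fun x (c : 'I_n -> k) =>
  (phi x : A^o) = \sum_i (kmap (c i) : A) *: v i); first exact: vE.
exists (fun t => c t.1 t.2).
rewrite -(pair_bigA _ (fun x i => (kmap (c x i) : A) *: w (x, i))) /=.
apply: eq_bigr => x _; rewrite [phi x in LHS]cE scaler_suml.
by apply: eq_bigr => i _; rewrite -scalerA.
Qed.

End ProjdimPd.

(** * Paths and algebras with a basis of normal paths *)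
Lemma addr_idem0 (V : zmodType) (x : V) : (x + x = x -> x = 0)%R.
Proof. by move=> /eqP; rewrite -subr_eq0 addrK => /eqP. Qed.

Section Scalars.
Local Open Scope ring_scope.
Context {k : pzRingType} {A : pzAlgType k}.
Lemma kmap0 : kmap 0 = 0 :> A.
Proof. by have := kmapB (s := A) 0 0; rewrite !subrr. Qed.
Lemma kmapN c : kmap (- c) = - kmap c :> A.
Proof. by have := kmapB (s := A) 0 c; rewrite kmap0 !sub0r. Qed.
Lemma kmapD c d : kmap (c + d) = kmap c + kmap d :> A.
Proof. by have := kmapB (s := A) c (- d); rewrite kmapN !opprK. Qed.
Lemma kmap_sum (I : Type) (s : seq I) (P : pred I) (F : I -> k) :
  kmap (\sum_(i <- s | P i) F i) = \sum_(i <- s | P i) kmap (F i) :> A.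
Proof. by apply: (big_morph kmap); [apply: kmapD|apply: kmap0]. Qed.
End Scalars.

Section PathCombinatorics.
Context {Q : quiver}.
Implicit Types (p q r : qpath Q) (a b : arrow Q).

(** Paths are traversed from right to left, so that [b] comes first.  Left
    multiplication preserves the first arrow, which is why paths are taken apart
    at this end. *)
Definition path_rcons p b := path_cat p (arrow_path b).

Lemma path_rcons_arrows p b : path_src p = tgt b ->
  path_arrows (path_rcons p b) = rcons (path_arrows p) b.
Proof. by move=> pb; rewrite path_cat_arrows // cats1. Qed.

Lemma path_rcons_src p b : path_src p = tgt b -> path_src (path_rcons p b) = src b.
Proof. by move=> pb; rewrite path_cat_src. Qed.

Lemma path_rcons_tgt p b : path_src p = tgt b -> path_tgt (path_rcons p b) = path_tgt p.
Proof. by move=> pb; rewrite path_cat_tgt. Qed.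

Lemma path_rcons_length p b : path_src p = tgt b ->
  path_length (path_rcons p b) = (path_length p).+1.
Proof. by move=> pb; rewrite /path_length path_rcons_arrows // size_rcons. Qed.

Lemma qpath_eqP p q : path_tgt p = path_tgt q -> path_arrows p = path_arrows q -> p = q.
Proof.
move=> pqt pqa; apply: val_inj; move: pqt pqa.
by rewrite /path_tgt /path_arrows; case: (val p) (val q) => ? ? [? ?] /= -> ->.
Qed.

Lemma path_lastP p : (exists i, p = vertex_path i) \/
  (exists p' b, path_src p' = tgt b /\ p = path_rcons p' b).
Proof.
case: p => -[v s]; case: (lastP s) => [|s' b] ps.
  by left; exists v; apply: val_inj.
have : is_path v (s' ++ [:: b]) by rewrite cats1.
rewrite is_path_cat /= andbT => /andP[ps' /eqP sb].
right; exists (exist _ (v, s') ps'), b; split=> //.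
by apply: qpath_eqP; rewrite ?path_rcons_tgt ?path_rcons_arrows.
Qed.

Lemma qpath_rcons_ind (K : qpath Q -> Prop) :
  (forall i, K (vertex_path i)) ->
  (forall p b, path_src p = tgt b -> K p -> K (path_rcons p b)) -> forall p, K p.
Proof.
move=> K0 KS p; have [n] := ubnP (path_length p); elim: n p => // n IH p.
have [[i ->]//|[p' [b [pb ->]]]] := path_lastP p.
by rewrite path_rcons_length // ltnS => pn; apply: KS => //; apply: IH.
Qed.

Lemma path_rcons_inj p p' b b' : path_src p = tgt b -> path_src p' = tgt b' ->
  path_rcons p b = path_rcons p' b' -> p = p' /\ b = b'.
Proof.
move=> pb pb' E; have := congr1 path_arrows E; rewrite !path_rcons_arrows //.
move=> /rcons_inj[pp' bb']; split=> //; apply: qpath_eqP => //.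
by have := congr1 path_tgt E; rewrite !path_rcons_tgt.
Qed.

End PathCombinatorics.

Section NormalPaths.
Context {Q : quiver}.
Variable Z : rel (arrow Q).
Implicit Types (p q r : qpath Q) (a b : arrow Q).

(** [Z b a] means that [a] followed by [b] is a relation. *)
Definition normal p := sorted (fun b a => ~~ Z b a) (path_arrows p).

Lemma normal_cat p q : path_src p = path_tgt q -> normal (path_cat p q) ->
  normal p /\ normal q.
Proof. by move=> pq; rewrite /normal path_cat_arrows // => /cat_sorted2[-> ->]. Qed.

Lemma normal_rcons p b : path_src p = tgt b -> normal (path_rcons p b) -> normal p.
Proof. by move=> pb /normal_cat[]. Qed.

Lemma normal_rcons2 p b a : path_src p = tgt b -> src b = tgt a ->
  normal (path_rcons (path_rcons p b) a) = normal (path_rcons p b) && ~~ Z b a.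
Proof.
move=> pb ba; rewrite /normal !path_rcons_arrows ?path_rcons_src //.
case: (path_arrows p) => [|c s] /=; first by rewrite andbT.
by rewrite !rcons_path last_rcons.
Qed.

End NormalPaths.

Section BoundedPaths.
Context {Q : quiver}.

Fixpoint bounded_paths n : seq (qpath Q) :=
  if n is n'.+1 then
    bounded_paths n' ++ [seq path_rcons p b | p <- bounded_paths n', b <- enum (arrow Q)]
  else [seq vertex_path i | i <- enum (vertex Q)].

Lemma bounded_pathsP n p : path_length p <= n -> p \in bounded_paths n.
Proof.
elim: n p => [|n IH] p; have [[i ->]|[p' [b [pb ->]]]] := path_lastP p.
- by move=> _ /=; apply: map_f; rewrite mem_enum.
- by rewrite path_rcons_length.
- by move=> _ /=; rewrite mem_cat IH.
rewrite path_rcons_length // ltnS => /IH pn.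
by rewrite mem_cat; apply/orP; right; apply/allpairsP; exists (p', b); rewrite mem_enum.
Qed.
End BoundedPaths.

Section MonomialBasis.
Local Open Scope ring_scope.
Context {k : fieldType} {Q : quiver}.
Variable Z : rel (arrow Q).

(** An algebra with the normal paths as a multiplicative basis: it is the path
    algebra modulo the paths [b a] with [Z b a].  The last field says that an
    element is a combination of the paths at which it has a nonzero coefficient. *)
Record monomial_basis (A : pzAlgType k) := MonomialBasis {
  basis_elt : qpath Q -> A;
  basis_coef : qpath Q -> A -> k;
  sum_vertices : \sum_i basis_elt (vertex_path i) = 1;
  cl_mul : forall p q,
    basis_elt p * basis_elt q = if path_src p == path_tgt q then basis_elt (path_cat p q) else 0;
  cl_not_normal : forall p, ~~ normal Z p -> basis_elt p = 0;
  coefP : forall p c x y, basis_coef p (kmap c * x + y) = c * basis_coef p x + basis_coef p y;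
  coef_cl : forall p q, basis_coef p (basis_elt q) = (normal Z p && (p == q))%:R;
  coef_ind : forall (K : A -> Prop) z,
    K 0 -> (forall c x y, K x -> K y -> K (kmap c * x + y)) ->
    (forall p, basis_coef p z != 0 -> K (basis_elt p)) -> K z
}.

Arguments sum_vertices {A}.
Arguments cl_mul {A} {m}.
Arguments cl_not_normal {A} {m}.
Arguments coefP {A} {m}.
Arguments coef_cl {A} {m}.
Arguments coef_ind {A} {m} K z.

Context {A : pzAlgType k}.
Variable B : monomial_basis A.
Variable N : nat.
Hypothesis normal_length : forall p, normal Z p -> (path_length p <= N)%N.
Hypothesis Zcomp : forall b a, Z b a -> src b = tgt a.

Local Notation cl := (basis_elt B).
Local Notation coef := (basis_coef B).
Implicit Types (p q r : qpath Q) (a b : arrow Q) (x y z : A).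

Definition vertex_elt i : A := cl (vertex_path i).
Definition arrow_elt a : A := cl (arrow_path a).
Local Notation ev := vertex_elt.
Local Notation xa := arrow_elt.

Lemma coef0 p : coef p 0 = 0.
Proof.
by apply: addr_idem0; have := coefP (m := B) p 1 0 0; rewrite kmap1 !mul1r addr0 => <-.
Qed.
Lemma coefZ p c x : coef p (kmap c * x) = c * coef p x.
Proof. by rewrite -[kmap c * x]addr0 coefP coef0 addr0. Qed.
Lemma coefD p x y : coef p (x + y) = coef p x + coef p y.
Proof.
by have := coefP (m := B) p 1 x y; rewrite kmap1 !mul1r.
Qed.
Lemma coefN p x : coef p (- x) = - coef p x.
Proof. by apply/eqP; rewrite -addr_eq0 addrC -coefD subrr coef0. Qed.
Lemma coef_sum p (I : Type) (s : seq I) (P : pred I) (F : I -> A) :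
  coef p (\sum_(i <- s | P i) F i) = \sum_(i <- s | P i) coef p (F i).
Proof. by apply: (big_morph (coef p)); [apply: coefD|apply: coef0]. Qed.

Lemma coef_normal p z : coef p z != 0 -> normal Z p.
Proof.
move=> pz; apply/negPn/negP => pN; move: pz; apply/negP/negPn/eqP.
apply: (coef_ind (m := B) (fun x => coef p x = 0)) => [|c x y px py|q _].
- exact: coef0.
- by rewrite coefP px py mulr0 addr0.
- by rewrite coef_cl (negPf pN).
Qed.

Lemma coef_eq0 z : (forall p, coef p z = 0) -> z = 0.
Proof.
move=> z0; apply: (coef_ind (m := B) (fun x => x = 0)) => // [c x y -> ->|p].
  by rewrite mulr0 addr0.
by rewrite z0 eqxx.
Qed.

Implicit Types (phi psi : A -> A).

Definition k_linear phi := forall c x y, phi (kmap c * x + y) = kmap c * phi x + phi y.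

Lemma k_linear_id : k_linear id. Proof. by []. Qed.
Lemma k_linear0 : k_linear (fun=> 0). Proof. by move=> c x y; rewrite mulr0 addr0. Qed.
Lemma k_linearD phi psi : k_linear phi -> k_linear psi -> k_linear (fun x => phi x + psi x).
Proof. by move=> fL gL c x y; rewrite fL gL mulrDr addrACA. Qed.
Lemma k_linear_sum (I : Type) (s : seq I) (P : pred I) (F : I -> A -> A) :
  (forall i, k_linear (F i)) -> k_linear (fun x => \sum_(i <- s | P i) F i x).
Proof.
move=> FL c x y; rewrite mulr_sumr -big_split /=.
by apply: eq_bigr => i _; apply: FL.
Qed.
Lemma k_linear_mulr z phi : k_linear phi -> k_linear (fun x => phi x * z).
Proof. by move=> fL c x y; rewrite fL mulrDl mulrA. Qed.
Lemma k_linear_coef p z : k_linear (fun x => kmap (coef p x) * z).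
Proof.
by move=> c x y; rewrite coefP kmapD kmapM mulrDl mulrA.
Qed.

Lemma k_linear_ext phi psi : k_linear phi -> k_linear psi ->
  (forall p, normal Z p -> phi (cl p) = psi (cl p)) -> phi =1 psi.
Proof.
move=> fL gL fg z; apply: (coef_ind (m := B) (fun z => phi z = psi z)) => [|c x y fx fy|p].
- have z0 h : k_linear h -> h 0 = 0.
    by move=> hL; apply: addr_idem0; have := hL 1 0 0; rewrite kmap1 !mul1r addr0.
  by rewrite !z0.
- by rewrite fL gL fx fy.
- by move=> /coef_normal; apply: fg.
Qed.

Lemma class_xa p b : path_src p = tgt b -> cl p * xa b = cl (path_rcons p b).
Proof. by move=> pb; rewrite cl_mul [path_tgt _]/= pb eqxx. Qed.

Lemma class_xa0 p b : path_src p <> tgt b -> cl p * xa b = 0.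
Proof. by rewrite cl_mul => /eqP/negPf ->. Qed.

Lemma class_ev p i : cl p * ev i = if path_src p == i then (cl p) else 0.
Proof. by rewrite cl_mul -[path_tgt (vertex_path i)]/i; case: eqP => // <-; rewrite path_catp1. Qed.

Lemma ev_class p i : ev i * cl p = if i == path_tgt p then (cl p) else 0.
Proof. by rewrite cl_mul -[path_src (vertex_path i)]/i; case: eqP => // ->; rewrite path_cat1p. Qed.

Lemma ev_idem i : ev i * ev i = ev i.
Proof. by rewrite class_ev eqxx. Qed.

Lemma xa_ev a i : xa a * ev i = if src a == i then xa a else 0.
Proof. exact: class_ev. Qed.

Lemma ev_xa a i : ev i * xa a = if i == tgt a then xa a else 0.
Proof. exact: ev_class. Qed.

Lemma sum_ev : \sum_i ev i = 1. Proof. exact: sum_vertices. Qed.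

(** Removes [b] from the start: a normal path [p b] is sent to [p], and the
    normal paths which do not start with [b] to 0. *)
Definition strip_arrow b z : A :=
  \sum_(p <- undup (bounded_paths N) | path_src p == tgt b)
    kmap (coef (path_rcons p b) z) * (cl p).
Local Notation strip := strip_arrow.

Lemma stripP b : k_linear (strip b).
Proof.
have := k_linear_sum (undup (bounded_paths N)) (fun p => path_src p == tgt b)
  (fun p => k_linear_coef (path_rcons p b) (cl p)).
exact.
Qed.
Lemma k_linear_strip b phi : k_linear phi -> k_linear (fun x => strip b (phi x)).
Proof. by move=> fL c x y; rewrite fL stripP. Qed.
Lemma stripD b x y : strip b (x + y) = strip b x + strip b y.
Proof. by have := stripP b 1 x y; rewrite kmap1 !mul1r. Qed.
Lemma strip0 b : strip b 0 = 0.
Proof. by apply: addr_idem0; rewrite -stripD addr0. Qed.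
Lemma strip_sum b (I : Type) (s : seq I) (P : pred I) (F : I -> A) :
  strip b (\sum_(i <- s | P i) F i) = \sum_(i <- s | P i) strip b (F i).
Proof. by apply: (big_morph (strip b)); [apply: stripD|apply: strip0]. Qed.

Lemma strip_vertex b i : strip b (ev i) = 0.
Proof.
rewrite /strip_arrow big1 // => p /eqP pb; rewrite coef_cl.
case: eqP => [/(congr1 path_arrows)|_]; last by rewrite andbF kmap0 mul0r.
by rewrite path_rcons_arrows //; case: (path_arrows p).
Qed.

Lemma strip_rcons b p a : path_src p = tgt a -> strip b (cl (path_rcons p a)) =
  if (a == b) && normal Z (path_rcons p a) then (cl p) else 0.
Proof.
move=> pa; rewrite /strip; case: eqVneq => [<- /=|ab]; last first.
  rewrite big1 // => q /eqP qb; rewrite coef_cl; case: eqP => [|_].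
    by case/path_rcons_inj=> // _ ba; rewrite ba eqxx in ab.
  by rewrite andbF kmap0 mul0r.
case: ifPn => [pn|pN]; last first.
  by rewrite cl_not_normal // big1 // => q _; rewrite coef0 kmap0 mul0r.
rewrite -big_filter (bigD1_seq p) ?filter_uniq ?undup_uniq //=; last first.
  rewrite mem_filter pa eqxx mem_undup; apply/bounded_pathsP/normal_length.
  exact: normal_rcons pn.
rewrite coef_cl pn eqxx kmap1 mul1r big1_seq ?addr0 // => q.
rewrite mem_filter => /andP[qp /andP[/eqP qa _]].
rewrite coef_cl; case: eqP => [|_]; last by rewrite andbF kmap0 mul0r.
by case/path_rcons_inj => // qp'; rewrite qp' eqxx in qp.
Qed.

Lemma strip_ev b z : strip b z * ev (tgt b) = strip b z.
Proof.
apply: (k_linear_ext (phi := fun z => strip b z * ev (tgt b)) (psi := strip b)) => [||p _].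
- exact/k_linear_mulr/k_linear_strip.
- exact/k_linear_strip.
have [[i ->]|[p' [a [pa ->]]]] := path_lastP p.
  by rewrite -/(vertex_elt i) strip_vertex mul0r.
rewrite strip_rcons //; case: ifP => [/andP[/eqP <- _]|_]; last by rewrite mul0r.
by rewrite class_ev pa eqxx.
Qed.

Lemma strip_xa_neq b a z : a != b -> strip b (z * xa a) = 0.
Proof.
move=> ab; apply: (k_linear_ext (phi := fun z => strip b (z * xa a)) (psi := fun=> 0)) => [||p _].
- exact/k_linear_strip/k_linear_mulr.
- exact: k_linear0.
have [pa|pa] := eqVneq (path_src p) (tgt a).
  by rewrite class_xa // strip_rcons // (negPf ab).
by rewrite class_xa0 ?strip0 //; apply/eqP.
Qed.

(** A path of positive length starts with exactly one arrow. *)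
Lemma ev_xa_decomp z :
  z = \sum_i kmap (coef (vertex_path i) z) * ev i + \sum_b strip b z * xa b.
Proof.
apply: (k_linear_ext (phi := id) (psi := fun z => \sum_i kmap (coef (vertex_path i) z) * ev i
  + \sum_b strip b z * xa b)) => [||p pn].
- exact: k_linear_id.
- apply: k_linearD; apply: k_linear_sum => i; first exact: k_linear_coef.
  exact/k_linear_mulr/k_linear_strip.
have [[i ->]|[p' [a [pa pE]]]] := path_lastP p.
  rewrite [X in _ + X]big1 => [|b _]; last by rewrite -/(vertex_elt i) strip_vertex mul0r.
  rewrite (bigD1 i) //= big1 => [|j ji].
    by rewrite coef_cl eqxx kmap1 mul1r !addr0.
  rewrite coef_cl; case: eqP => [[/eqP]|_]; first by rewrite (negPf ji).
  by rewrite andbF kmap0 mul0r.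
rewrite pE in pn *; rewrite big1 => [|j _]; last first.
  rewrite coef_cl; case: eqP => [/(congr1 path_arrows)|_].
    by rewrite path_rcons_arrows //; case: (path_arrows p').
  by rewrite andbF kmap0 mul0r.
rewrite add0r (bigD1 a) //= big1 => [|b ba].
  by rewrite strip_rcons // eqxx pn /= class_xa // addr0.
by rewrite strip_rcons // eq_sym (negPf ba) mul0r.
Qed.

Lemma xa_rel b a : Z b a -> xa b * xa a = 0.
Proof.
move=> ba; have pa : path_src (arrow_path b) = tgt a by apply: Zcomp.
rewrite [LHS](class_xa pa); apply: cl_not_normal.
by rewrite /normal path_rcons_arrows //= ba.
Qed.

(** If a normal path [p = p' b] can follow [a], either [Z b a] and
    [p a = 0], so that the first sum recovers [p], or [p a] is normal and
    stripping [a] recovers [p].  This describes the kernel of right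
    multiplication by [a], and is also the contracting homotopy of the Koszul
    complex. *)
Lemma xa_syzygy a z : z * ev (tgt a) =
  \sum_(b | Z b a) strip b z * xa b + strip a (z * xa a).
Proof.
apply: (k_linear_ext (phi := fun z => z * ev (tgt a)) (psi := fun z =>
  \sum_(b | Z b a) strip b z * xa b + strip a (z * xa a))) => [||p pn].
- exact/k_linear_mulr/k_linear_id.
- apply: k_linearD; last exact/k_linear_strip/k_linear_mulr/k_linear_id.
  by apply: k_linear_sum => i; apply/k_linear_mulr/k_linear_strip/k_linear_id.
rewrite class_ev; have [pa|pa] := eqVneq (path_src p) (tgt a); last first.
  rewrite class_xa0; last exact/eqP.
  rewrite strip0 addr0 big1 // => b ba.
  have [[i ->]|[p' [c [pc pE]]]] := path_lastP p; first by rewrite strip_vertex mul0r.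
  rewrite pE strip_rcons //; case: eqP => [cb|]; last by rewrite mul0r.
  by move: pa; rewrite pE path_rcons_src // cb (Zcomp ba) eqxx.
rewrite class_xa // strip_rcons // eqxx /=.
have [[i pE]|[p' [c [pc pE]]]] := path_lastP p.
  rewrite big1 => [|b _]; last by rewrite pE -/(vertex_elt i) strip_vertex mul0r.
  rewrite add0r; suff -> : normal Z (path_rcons p a) by [].
  by rewrite /normal path_rcons_arrows // pE.
have ca : src c = tgt a by rewrite -pa pE path_rcons_src.
rewrite pE (normal_rcons2 Z) // -pE pn /=.
have sE b : strip b (cl p) * xa b = if b == c then (cl p) else 0.
  rewrite pE strip_rcons // -pE pn andbT eq_sym; case: eqP => [->|]; last by rewrite mul0r.
  by rewrite class_xa // -pE.
case: ifPn => [caN|]; last rewrite negbK => caZ.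
  rewrite big1 ?add0r // => b ba; rewrite sE; case: eqP => // bc.
  by rewrite -bc ba in caN.
rewrite addr0 (bigD1 c) //= sE eqxx big1 ?addr0 // => b /andP[_ bc].
by rewrite sE (negPf bc).
Qed.

Lemma strip_xa a z : strip a (z * xa a) * xa a = z * xa a.
Proof.
have /(congr1 ( *%R^~ (xa a))) := xa_syzygy a z.
rewrite -mulrA ev_xa eqxx mulrDl mulr_suml big1 ?add0r // => b ba.
by rewrite -mulrA xa_rel ?mulr0.
Qed.

End MonomialBasis.

(** * Quotients of the path algebra by monomial ideals *)
Section PathCoefficients.
Local Open Scope ring_scope.
Context {k : fieldType} {Q : quiver}.
Local Notation kQ := (path_algebra k Q).
Implicit Types (f g : kQ) (p q r : qpath Q).

Definition kcoef p f : k := mcoeff p (f : {malg k[qpath Q]}).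

Lemma kcoefP c p f g : kcoef p (c *: f + g) = c * kcoef p f + kcoef p g.
Proof. by rewrite /kcoef mcoeffD mcoeffZ. Qed.
Lemma kcoef0 p : kcoef p 0 = 0. Proof. exact: mcoeff0. Qed.
Lemma kcoefD p f g : kcoef p (f + g) = kcoef p f + kcoef p g.
Proof. exact: mcoeffD. Qed.
Lemma kcoefB p f g : kcoef p (f - g) = kcoef p f - kcoef p g.
Proof. exact: mcoeffB. Qed.
Lemma kcoef_elt p q : kcoef p (path_elt q) = (p == q)%:R.
Proof. by rewrite unlock /kcoef mcoeffU eq_sym. Qed.

Lemma kcoef_ind (K : kQ -> Prop) f :
  K 0 -> (forall c g h, K g -> K h -> K (c *: g + h)) ->
  (forall p, kcoef p f != 0 -> K (path_elt p)) -> K f.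
Proof.
move=> K0 KD Kp; rewrite [f]kQ_elt_sum big_seq.
elim/big_rec: _ => // p g pf Kg; apply: KD => //; apply: Kp.
by rewrite mcoeff_neq0.
Qed.

Lemma kcoefM_supp r f g : kcoef r (f * g) != 0 -> exists p q,
  [/\ path_src p = path_tgt q, r = path_cat p q, kcoef p f != 0 & kcoef q g != 0].
Proof.
pose S (h : kQ) := forall r, kcoef r h != 0 -> exists p q,
  [/\ path_src p = path_tgt q, r = path_cat p q, kcoef p f != 0 & kcoef q g != 0].
have S0 : S 0 by move=> r'; rewrite kcoef0 eqxx.
have SP c h h' : S h -> S h' -> S (c *: h + h').
  move=> Sh Sh' r'; rewrite kcoefP.
  have [->|] := eqVneq (kcoef r' h) 0; last by move=> /Sh.
  by rewrite mulr0 add0r; apply: Sh'.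
suff: S (f * g) by apply.
rewrite -[f * g]/(kQ_mul f g).
apply: (@kcoef_ind (fun f' => S (kQ_mul f' g))) => [|c h h' Sh Sh'|p pf].
- by rewrite kQ_mul0l.
- by rewrite kQ_mulDl kQ_mulZl; apply: SP.
apply: (@kcoef_ind (fun g' => S (kQ_mul _ g'))) => [|c h h' Sh Sh'|q qg].
- by rewrite kQ_mul0r.
- by rewrite kQ_mulDr kQ_mulZr; apply: SP.
rewrite kQ_mul_elt /path_mul; case: eqP => // pq r'; rewrite kcoef_elt.
by case: (r' =P _) => [->|_]; rewrite ?eqxx //; exists p, q.
Qed.

End PathCoefficients.

Section MonomialAlgebra.
Local Open Scope ring_scope.
Context {k : fieldType} {Q : quiver}.
Variable Z : rel (arrow Q).
Local Notation kQ := (path_algebra k Q).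
Implicit Types (f g : kQ) (p q r : qpath Q) (a b : arrow Q).

Definition mon_ideal_set : set kQ := [set f | forall p, normal Z p -> kcoef p f = 0]%classic.

Lemma mon_ideal0 : mon_ideal_set 0.
Proof. by move=> p _; apply: kcoef0. Qed.
Lemma mon_idealD f g : mon_ideal_set f -> mon_ideal_set g -> mon_ideal_set (f + g).
Proof. by move=> If Ig p pn; rewrite kcoefD If ?Ig ?addr0. Qed.
Lemma mon_idealMl f g : mon_ideal_set g -> mon_ideal_set (f * g).
Proof.
move=> Ig r rn; apply/eqP/negPn/negP => /kcoefM_supp[p [q [pq rE _ /negP[]]]].
by apply/eqP/Ig; move: rn; rewrite rE => /normal_cat[].
Qed.
Lemma mon_idealMr f g : mon_ideal_set g -> mon_ideal_set (g * f).
Proof.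
move=> Ig r rn; apply/eqP/negPn/negP => /kcoefM_supp[p [q [pq rE /negP pg _]]].
by apply: pg; apply/eqP/Ig; move: rn; rewrite rE => /normal_cat[].
Qed.

Definition mon_ideal : ideal kQ := Ideal mon_ideal0 mon_idealD mon_idealMl mon_idealMr.

Local Notation A := (quot_alg mon_ideal).
Local Notation proj := (@quot_proj k kQ mon_ideal).
Local Notation cl := (path_class mon_ideal).
Implicit Types x y z : A.

Lemma projP c f g : proj (c *: f + g) = kmap c * proj f + proj g.
Proof.
rewrite quot_projD; congr (_ + _).
rewrite -[RHS]/(quot_mul _ _) quot_projM; congr quot_proj.
by rewrite -[RHS]/(kQ_mul _ _) kQ_mulZl kQ_mul1l.
Qed.

Lemma proj0 : proj 0 = 0.
Proof. by apply: addr_idem0; rewrite -quot_projD addr0. Qed.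

Lemma projM f g : proj (f * g) = proj f * proj g.
Proof. by rewrite -[RHS]/(quot_mul _ _) quot_projM. Qed.

Lemma proj_eq0 f : proj f = 0 <-> forall p, normal Z p -> kcoef p f = 0.
Proof. by rewrite -proj0 quot_projP subr0. Qed.

Lemma not_normal_class p : ~~ normal Z p -> cl p = 0.
Proof.
move=> pN; apply/proj_eq0 => q qn; rewrite kcoef_elt.
by case: eqP => // qp; rewrite -qp qn in pN.
Qed.

Lemma classM p q :
  cl p * cl q = if path_src p == path_tgt q then (cl (path_cat p q)) else 0.
Proof.
rewrite /path_class -projM -[_ * _]/(kQ_mul _ _) kQ_mul_elt /path_mul.
by case: ifP => // _; rewrite proj0.
Qed.

(** For normal [p], the coefficient does not depend on the representative, as no
    element of the ideal involves [p]. *)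
Definition mon_coef p z : k := if normal Z p then kcoef p (quot_repr z) else 0.

Lemma mon_coef_proj p f : mon_coef p (proj f) = if normal Z p then kcoef p f else 0.
Proof.
rewrite /mon_coef; case: ifP => // pn; apply/eqP; rewrite -subr_eq0 -kcoefB; apply/eqP.
exact: ((@quot_repr_proj k kQ mon_ideal f : mon_ideal_set _) p pn).
Qed.

Lemma mon_coef_class p q : mon_coef p (cl q) = (normal Z p && (p == q))%:R.
Proof. by rewrite mon_coef_proj kcoef_elt; case: ifP. Qed.

Lemma mon_coefP p c x y : mon_coef p (kmap c * x + y) = c * mon_coef p x + mon_coef p y.
Proof.
rewrite -(quot_reprK x) -(quot_reprK y) -projP !mon_coef_proj; case: ifP => _.
  exact: kcoefP.
by rewrite mulr0 addr0.
Qed.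

Lemma mon_coef_ind (K : A -> Prop) z :
  K 0 -> (forall c x y, K x -> K y -> K (kmap c * x + y)) ->
  (forall p, mon_coef p z != 0 -> K (cl p)) -> K z.
Proof.
move=> K0 KD Kp; rewrite -(quot_reprK z).
apply: (@kcoef_ind _ _ (fun f => K (proj f))) => [|c f g Kf Kg|p pz].
- by rewrite proj0.
- by rewrite projP; apply: KD.
have [pn|pN] := boolP (normal Z p); last by rewrite -/(path_class _ _) not_normal_class.
by apply: Kp; rewrite /mon_coef pn.
Qed.

Lemma mon_sum_vertices : \sum_i (cl (vertex_path i)) = 1.
Proof.
rewrite -[1]/(proj kQ_one) /kQ_one.
by rewrite (big_morph proj (@quot_projD _ _ _) proj0).
Qed.

Definition mon_basis : monomial_basis Z A := MonomialBasis
  mon_sum_vertices classM not_normal_class mon_coefP mon_coef_class mon_coef_ind.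

End MonomialAlgebra.

(** * Left ideals generated by arrows, and the lower bound *)
Section LeftIdeals.
Local Open Scope ring_scope.
Context {k : fieldType} {Q : quiver} (Z : rel (arrow Q)).
Context {A : pzAlgType k}.
Variable B : monomial_basis Z A.
Variable N : nat.
Hypothesis normal_length : forall p, normal Z p -> (path_length p <= N)%N.
Hypothesis Zcomp : forall b a, Z b a -> src b = tgt a.

Local Notation cl := (basis_elt B).
Local Notation coef := (basis_coef B).
Local Notation ev := (vertex_elt B).
Local Notation xa := (arrow_elt B).
Local Notation strip := (strip_arrow B N).
Implicit Types (p q r : qpath Q) (a b : arrow Q) (y z : A).

Lemma fin_dim_regular : fin_dim (A^o : lmodType A).
Proof.
pose v (p : seq_sub (bounded_paths N)) : A^o := (cl (ssval p)).
pose K (z : A) : Prop := (z : A^o) = \sum_t (kmap (coef (ssval t) z) : A) *: v t.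
suff KZ z : K z.
  by apply: (fin_dim_span (v := v)) => z; exists (fun t => coef (ssval t) z); apply: KZ.
refine (@coef_ind _ _ _ _ B K z _ _ _); rewrite /K.
- by rewrite big1 // => t _; rewrite coef0 kmap0 scale0r.
- move=> c x y xE yE; rewrite {1}xE {1}yE -[kmap c * _]/(kmap c *: (_ : A^o)).
  rewrite scaler_sumr -big_split; apply: eq_bigr => t _ /=.
  by rewrite coefP kmapD kmapM scalerDl scalerA.
move=> q /coef_normal qn.
have qB := bounded_pathsP (normal_length qn).
rewrite (bigD1 (SeqSub qB)) //= coef_cl qn eqxx kmap1 scale1r big1 ?addr0 // => t tq.
rewrite coef_cl; case: eqP => [pqE|_]; last by rewrite andbF kmap0 scale0r.
by rewrite -val_eqE /= pqE eqxx in tq.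
Qed.

Section Corner.
Variable i : vertex Q.
Let S : set A^o := [set z : A | z * ev i = z]%classic.
Lemma proj_mod0 : S 0. Proof. exact: mul0r. Qed.
Lemma proj_modD (x y : A^o) : S x -> S y -> S (x + y).
Proof. by move=> xS yS; rewrite /S /= mulrDl xS yS. Qed.
Lemma proj_modZ (a : A) (x : A^o) : S x -> S (a *: x).
Proof. by move=> xS; rewrite /S /= -mulrA xS. Qed.
(** The projective left ideal [A e_i]. *)
Definition proj_set := Submodule proj_mod0 proj_modD proj_modZ.
Definition proj_mod : lmodType A := submod_type proj_set.

Lemma proj_modP (x : proj_mod) : (val x : A) * ev i = val x.
Proof. exact: (submod_valP x). Qed.

Definition proj_gen : proj_mod := submod_elt (ev_idem B i : submod_set proj_set (ev i)).

Lemma proj_gen_basis (x : proj_mod) : x = (val x : A) *: proj_gen.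
Proof. by apply: val_inj; rewrite linearZ /=; apply/esym/proj_modP. Qed.

Lemma proj_mod_projective : projective_module proj_mod.
Proof.
apply: (@dual_basis_projective A proj_mod unit (fun=> proj_gen) (fun=> submod_incl _)).
by move=> x; rewrite big_const card_unit /= addr0; apply: proj_gen_basis.
Qed.

Lemma proj_mod_fin_dim : fin_dim proj_mod.
Proof.
apply: (@fin_dim_generated k A proj_mod unit (fun=> proj_gen) fin_dim_regular) => x.
by exists (fun=> val x); rewrite big_const card_unit /= addr0; apply: proj_gen_basis.
Qed.

End Corner.

Section ArrowIdeal.
Variable P : pred (arrow Q).
Let S : set A^o := [set z : A | exists y : arrow Q -> A, z = \sum_(b | P b) y b * xa b]%classic.
Lemma arrows_mod0 : S 0.
Proof. by exists (fun=> 0); rewrite big1 // => b _; rewrite mul0r. Qed.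
Lemma arrows_modD (x y : A^o) : S x -> S y -> S (x + y).
Proof.
move=> [u ->] [v ->]; exists (fun b => u b + v b).
by rewrite -big_split; apply: eq_bigr => b _; rewrite /= mulrDl.
Qed.
Lemma arrows_modZ (a : A) (x : A^o) : S x -> S (a *: x).
Proof.
move=> [u ->]; exists (fun b => a * u b).
by rewrite scaler_sumr; apply: eq_bigr => b _; rewrite -mulrA.
Qed.
(** The left ideal generated by the arrows that satisfy [P]. *)
Definition arrows_set := Submodule arrows_mod0 arrows_modD arrows_modZ.

(** The sum of the left ideals [A x_b] is direct, with [z |-> strip b z * xa b] as
    its projections. *)
Lemma arrows_setP z : submod_set arrows_set z <-> z = \sum_(b | P b) strip b z * xa b.
Proof.
split=> [[y zE]|zE]; last by exists (fun b => strip b z).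
rewrite {1}zE; apply: eq_bigr => b Pb; rewrite zE strip_sum mulr_suml.
rewrite (bigD1 b) //= big1 => [|c /andP[_ cb]]; last by rewrite strip_xa_neq // mul0r.
by rewrite addr0 strip_xa.
Qed.

Lemma arrows_setM b y : P b -> submod_set arrows_set (y * xa b).
Proof.
move=> Pb; exists (fun c => if c == b then y else 0).
rewrite (bigD1 b) //= eqxx big1 ?addr0 // => c /andP[_ /negPf ->].
by rewrite mul0r.
Qed.
End ArrowIdeal.

Lemma arrows_setS (P P' : pred (arrow Q)) z :
  (forall b, P b -> P' b) -> submod_set (arrows_set P) z -> submod_set (arrows_set P') z.
Proof.
move=> PP' [y ->]; exists (fun b => if P b then y b else 0).
rewrite (bigID P P') /= [X in _ = _ + X]big1 => [|b /andP[_ /negPf ->]]; last by rewrite mul0r.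
rewrite addr0; apply: eq_big => [b|b ->//].
by have [/PP' ->|_] := boolP (P b); rewrite ?andbF.
Qed.

(** The left ideal [A x_a]. *)
Definition xa_mod a : lmodType A := submod_type (arrows_set (pred1 a)).

Lemma xa_modP a (x : xa_mod a) : exists y, val x = y * xa a.
Proof.
by have [y ->] := submod_valP x; exists (y a); rewrite big_pred1_eq.
Qed.

Lemma strip_linear (P : pred (arrow Q)) b y z : submod_set (arrows_set P) z ->
  strip b (y * z) * xa b = y * (strip b z * xa b).
Proof.
move=> /(arrows_setS (P' := xpredT) (fun _ _ => isT))[u ->].
have sE v : strip b (\sum_c v c * xa c) * xa b = v b * xa b.
  rewrite strip_sum (bigD1 b) //= big1 ?addr0 ?strip_xa // => c cb.
  exact: strip_xa_neq.
rewrite sE mulr_sumr (eq_bigr (fun c => (y * u c) * xa c)) ?sE ?mulrA // => c _.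
by rewrite mulrA.
Qed.

(** Inside a left ideal of combinations of paths of positive length, [A x_b] is a
    direct summand: project onto the paths which start with [b]. *)
Lemma xa_mod_retract (K : lmodType A) (j : {linear K -> A^o}) b :
  injective j -> (forall x : K, submod_set (arrows_set xpredT) (j x)) ->
  (forall y : A, exists x : K, j x = y * xa b) -> stable_retract (xa_mod b) K.
Proof.
move=> jI jT jb.
have [x|i iE] := @linear_lift A K (xa_mod b) A^o j (submod_incl _) jI.
  by have [y xE] := xa_modP x; have [x' x'E] := jb y; exists x'; rewrite x'E -xE.
have rL : linear (fun x : K => strip b (j x) * xa b : A^o).
  move=> a x y; rewrite linearP stripD mulrDl; congr (_ + _).
  exact: strip_linear (jT x).
have rV x : submod_set (arrows_set (pred1 b)) (linear_of rL x).
  by apply: arrows_setM; rewrite /= eqxx.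
apply: (@retract_stable_retract _ _ _ i (corestrict rV)) => x.
apply: val_inj; rewrite /= iE; have [y xE] := xa_modP x.
by rewrite [submod_incl _ x]xE strip_xa.
Qed.

Section XaCover.
Variable a : arrow Q.
Lemma xa_cover_linear : linear (fun x : proj_mod (tgt a) => (val x : A) * xa a : A^o).
Proof. by move=> c x y; rewrite linearP /= mulrDl -mulrA. Qed.
Lemma xa_cover_sub x : submod_set (arrows_set (pred1 a)) (linear_of xa_cover_linear x).
Proof. by apply: arrows_setM; rewrite /= eqxx. Qed.
Definition xa_cover : {linear proj_mod (tgt a) -> xa_mod a} := corestrict xa_cover_sub.

Lemma proj_elt_mul i z : submod_set (proj_set i) (z * ev i).
Proof. by rewrite /= -mulrA ev_idem. Qed.

Lemma xa_cover_surj : surjective xa_cover.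
Proof.
move=> x; have [y xE] := xa_modP x; exists (submod_elt (proj_elt_mul (tgt a) y)).
by apply: val_inj; rewrite /= xE -mulrA ev_xa eqxx.
Qed.
End XaCover.

(** Multiplication adds lengths. *)
Lemma coef_long r p q z : (path_length r < path_length p + path_length q)%N ->
  coef r (cl p * z * cl q) = 0.
Proof.
move=> rpq; refine (@coef_ind _ _ _ _ B (fun z => coef r (cl p * z * cl q) = 0) z _ _ _).
- by rewrite mulr0 mul0r coef0.
- move=> c x y x0 y0; rewrite mulrDr mulrDl mulrA -kmap_central -!mulrA coefP.
  by rewrite !mulrA x0 y0 mulr0 addr0.
move=> s _; rewrite cl_mul; case: eqP => ps; last by rewrite mul0r coef0.
rewrite cl_mul; case: eqP => sq; last by rewrite coef0.
rewrite coef_cl; case: eqP => [rE|_]; last by rewrite andbF.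
move: rpq; rewrite rE /path_length !path_cat_arrows // !size_cat ltnNge.
by rewrite leq_add2r leq_addr.
Qed.

(** If the surjection from [A e_(t a)] had a section, the image [u] of [x_a] would
    have coefficient 1 at the vertex, as [u x_a = x_a]; then [x_b u] has coefficient
    1 at the arrow [b].  But [x_b u] is the image of [x_b x_a = 0]. *)
Lemma xa_mod_not_projective a b : Z b a -> ~ projective_module (xa_mod a).
Proof.
move=> ba pa.
have [h hE] := pa _ _ (xa_cover a) idfun (@xa_cover_surj a).
have aV : submod_set (arrows_set (pred1 a)) (1 * xa a).
  by apply: arrows_setM; rewrite /= eqxx.
pose x0 : xa_mod a := submod_elt aV; pose u : A := val (h x0).
have ua : u * xa a = xa a.
  by have /(congr1 val)/= := hE x0; rewrite mul1r.
have bu : xa b * u = 0.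
  have x00 : xa b *: x0 = 0.
    by apply: val_inj; rewrite linearZ /= -[_ *: _]/(_ * _) mul1r xa_rel.
  by have := linearZZ h (xa b) x0; rewrite x00 linear0 => /(congr1 val)/esym.
have uE := xa_syzygy B normal_length Zcomp a u.
have uev : u * ev (tgt a) = u := proj_modP (h x0).
have sa : strip a (xa a) = ev (tgt a).
  have E : arrow_path a = path_rcons (vertex_path (tgt a)) a.
    by rewrite -[LHS]path_cat1p.
  by rewrite /arrow_elt E strip_rcons // eqxx -E.
rewrite uev ua sa in uE; move: bu; rewrite uE mulrDr mulr_sumr.
move=> /(congr1 (coef (arrow_path b))); rewrite coefD coef_sum coef0 big1 => [|c _].
  rewrite xa_ev (Zcomp ba) eqxx coef_cl eqxx /= add0r => /eqP.
  by rewrite oner_eq0.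
by rewrite mulrA; apply: coef_long.
Qed.

Section SimpleModule.
Variable i : vertex Q.

Definition rad_proj : submodule (proj_mod i) :=
  submod_in (arrows_set (fun b => src b == i)) (proj_set i).
Definition simple_mod : lmodType A := quot_mod rad_proj.

End SimpleModule.

(** A relation [Z b a] makes [A x_b] a summand of the syzygy of [A x_a].  Passing to
    it lowers the projective dimension by one, and [A x_a] is not projective. *)
Lemma pd_le_xa_mod n a c : path (fun a b => Z b a) a c -> pd_le n (xa_mod a) -> (size c <= n)%N.
Proof.
elim: c n a => //= b c IH n a /andP[ba bc] pda.
case: n pda => [/(xa_mod_not_projective ba) //|n pda]; rewrite ltnS; apply: IH bc _.
have se := lin_kernel_short_exact (@xa_cover_surj a).
have := pd_le_syzygy (@proj_mod_projective _) se pda.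
apply: pd_le_stable_retract.
pose K := submod_type (lin_kernel (xa_cover a)).
pose j : {linear K -> A^o} :=
  submod_incl (proj_set (tgt a)) \o submod_incl (lin_kernel (xa_cover a)).
apply: (@xa_mod_retract K j) => [x y /val_inj/val_inj //|x|y].
  have := submod_valP x => /lin_kernelP/(congr1 val)/=.
  set z : A := val (val x) => za.
  have zE : z = \sum_(b | Z b a) strip b z * xa b.
    have := xa_syzygy B normal_length Zcomp a z.
    by rewrite [z * xa a]za strip0 addr0 => <-; apply/esym/(proj_modP (val x)).
  change (submod_set (arrows_set xpredT) (z : A^o)); rewrite zE.
  apply: (@arrows_setS (fun b => Z b a)) => //.
  by exists (fun b => strip b z).
have yV : submod_set (proj_set (tgt a)) (y * xa b).
  by rewrite /= -mulrA xa_ev (Zcomp ba) eqxx.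
have yK : submod_set (lin_kernel (xa_cover a)) (submod_elt yV).
  apply/lin_kernelP/val_inj; rewrite /= -mulrA xa_rel ?mulr0 //.
by exists (submod_elt yK).
Qed.

Lemma pd_le_simple n a c : (0 < size c)%N -> path (fun a b => Z b a) a c ->
  pd_le n (simple_mod (src a)) -> (size c < n)%N.
Proof.
move=> c0 ac pdS; suff: (size c <= n.-1)%N.
  by case: n pdS => // _; rewrite leqNgt c0.
apply: pd_le_xa_mod ac _.
have {}pdS : pd_le n.-1.+1 (simple_mod (src a)) by case: n pdS => // /pd_leS.
have := pd_le_syzygy (@proj_mod_projective _) (quot_short_exact (rad_proj (src a))) pdS.
apply: pd_le_stable_retract.
pose K := submod_type (rad_proj (src a)).
pose j : {linear K -> A^o} := submod_incl (proj_set (src a)) \o submod_incl (rad_proj (src a)).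
apply: (@xa_mod_retract K j) => [x y /val_inj/val_inj //|x|y].
  by apply: arrows_setS (submod_valP x).
have yV : submod_set (proj_set (src a)) (y * xa a).
  by rewrite /= -mulrA xa_ev eqxx.
have yK : submod_set (rad_proj (src a)) (submod_elt yV).
  by apply: arrows_setM.
by exists (submod_elt yK).
Qed.

(** The chain consists of [a] followed by [c], hence has length [(size c).+1]. *)
Lemma gldim_ge_relation_chain n a c : (0 < size c)%N -> path (fun a b => Z b a) a c ->
  gldim_le A n -> (size c < n)%N.
Proof.
move=> c0 ac gl; apply: pd_le_simple c0 ac _.
apply/projdim_le_pd_le/gl.
apply: (@fin_dim_surj _ _ _ _ (quot_map (rad_proj (src a)))) => //.
  exact: quot_map_surj.
exact: proj_mod_fin_dim.
Qed.

End LeftIdeals.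

(** * The Koszul resolution, and the upper bound *)
Section HomogeneousBasis.
Local Open Scope ring_scope.
Context {k : fieldType} {Q : quiver} (Z : rel (arrow Q)).
Context {A : pzAlgType k}.
Variable B : monomial_basis Z A.
Variable M : lmodType A.
Local Notation ev := (vertex_elt B).
Local Notation "c %:A" := (kmap c : A) : ring_scope.

(** Homogeneous with respect to the decomposition of [M] into the [e_i M]. *)
Definition homogeneous_span n (m : 'I_n -> M) (nu : 'I_n -> vertex Q) :=
  (forall j, ev (nu j) *: m j = m j) /\
  forall x, exists c : 'I_n -> k, x = \sum_j (c j)%:A *: m j.

Lemma homogeneous_span_exists : fin_dim M -> exists n m nu, @homogeneous_span n m nu.
Proof.
move=> [n [v vE]]; pose T : finType := (vertex Q * 'I_n)%type.
exists #|T|, (fun t => ev (enum_val t).1 *: v (enum_val t).2).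
exists (fun t => (enum_val t).1); split=> [j|x].
  by rewrite scalerA ev_idem.
have [c ->] := vE x; exists (fun t => c (enum_val t).2).
transitivity (\sum_(t : T) (c t.2)%:A *: (ev t.1 *: v t.2)); last first.
  by rewrite (reindex _ (onW_bij _ (@enum_val_bij T))).
rewrite -(pair_bigA _ (fun i j => (c j)%:A *: (ev i *: v j))) /= exchange_big /=.
by apply: eq_bigr => j _; rewrite -scaler_sumr -scaler_suml sum_ev scale1r.
Qed.

(** A homogeneous spanning family of minimal size is free. *)
Lemma homogeneous_basis_exists : fin_dim M -> exists n m nu,
  @homogeneous_span n m nu /\
  forall c : 'I_n -> k, \sum_j (c j)%:A *: m j = 0 -> forall j, c j = 0.
Proof.
move=> /homogeneous_span_exists[n0 [m0 [nu0 sp0]]].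
pose Pn n := `[< exists m nu, @homogeneous_span n m nu >].
have exP : exists n, Pn n by exists n0; apply/asboolP; exists m0, nu0.
case: (ex_minnP exP) => n /asboolP[m [nu [hm sp]]] nmin.
exists n, m, nu; split=> // c cm j0; apply/eqP/negPn/negP => cj0.
case: n => [|n] in m nu hm sp nmin c cm j0 cj0 *; first by case: j0 {cj0}.
(* A dependency with a nonzero coefficient at [j0] makes [m j0] superfluous. *)
suff /nmin : Pn n by rewrite ltnn.
apply/asboolP; exists (m \o lift j0), (nu \o lift j0); split=> [j|x]; first exact: hm.
have [e xE] := sp x; exists (fun j => e (lift j0 j) - e j0 / c j0 * c (lift j0 j)).
pose f j := e j - e j0 / c j0 * c j.
have -> : x = \sum_j (f j)%:A *: m j.
  have : (e j0 / c j0)%:A *: \sum_j (c j)%:A *: m j = 0 by rewrite cm scaler0.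
  rewrite scaler_sumr => cm0; rewrite xE; apply/eqP; rewrite -subr_eq0 -sumrB; apply/eqP.
  rewrite -[RHS]cm0; apply: eq_bigr => j _.
  by rewrite -scalerBl -kmapB scalerA -kmapM /f opprB addrC subrK.
by rewrite (bigD1_ord j0) //= {1}/f mulfVK // subrr kmap0 scale0r add0r.
Qed.

End HomogeneousBasis.

Section KoszulComplex.
Local Open Scope ring_scope.
Context {k : fieldType} {Q : quiver} (Z : rel (arrow Q)).
Context {A : pzAlgType k}.
Variable B : monomial_basis Z A.
Variable N : nat.
Hypothesis normal_length : forall p, normal Z p -> (path_length p <= N)%N.
Hypothesis Zcomp : forall b a, Z b a -> src b = tgt a.
Variable M : lmodType A.
Variables (nb : nat) (m : 'I_nb -> M) (nu : 'I_nb -> vertex Q).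
Hypothesis m_span : homogeneous_span B m nu.
Hypothesis m_free : forall c : 'I_nb -> k, \sum_j (kmap (c j) : A) *: m j = 0 -> forall j, c j = 0.

Local Notation coef := (basis_coef B).
Local Notation ev := (vertex_elt B).
Local Notation xa := (arrow_elt B).
Local Notation strip := (strip_arrow B N).
Local Notation "c %:A" := (kmap c : A) : ring_scope.
Local Notation Q1 := (arrow Q).
Implicit Types (p q r : qpath Q) (a b : Q1) (i j : 'I_nb).

Lemma m_unique (c d : 'I_nb -> k) :
  \sum_j (c j)%:A *: m j = \sum_j (d j)%:A *: m j -> forall j, c j = d j.
Proof.
move=> cd j; apply/eqP; rewrite -subr_eq0; apply/eqP.
apply: (m_free (c := fun j => c j - d j)).
under eq_bigr => l _ do rewrite kmapB scalerBl.
by rewrite sumrB cd subrr.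
Qed.

Lemma m_coord_exists : exists co : M -> 'I_nb -> k, forall x, x = \sum_j (co x j)%:A *: m j.
Proof. by have [co coE] := @choice _ _ _ m_span.2; exists co. Qed.

Definition coord := projT1 (cid m_coord_exists).
Lemma coordE x : x = \sum_j (coord x j)%:A *: m j.
Proof. exact: (projT2 (cid m_coord_exists)). Qed.

(** Structure constants of [M]: row [i] expresses [a] applied to [m i]. *)
Definition amat a i j : k := coord (xa a *: m i) j.

Lemma amatE a i : xa a *: m i = \sum_j (amat a i j)%:A *: m j.
Proof. exact: coordE. Qed.

Lemma amat_supp a i j : amat a i j != 0 -> nu i = src a /\ nu j = tgt a.
Proof.
move=> aij; split; apply/eqP/negPn/negP => neq; move: aij.
  suff -> : amat a i j = 0 by rewrite eqxx.
  apply: (m_free (c := amat a i)); rewrite -amatE -(m_span.1 i) scalerA xa_ev.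
  by rewrite eq_sym (negPf neq) scale0r.
suff -> : amat a i j = 0 by rewrite eqxx.
have E : \sum_l (amat a i l)%:A *: m l =
         \sum_l ((if nu l == tgt a then amat a i l else 0)%:A) *: m l.
  rewrite -amatE -[in LHS](_ : ev (tgt a) * xa a = xa a); last by rewrite ev_xa eqxx.
  rewrite -scalerA amatE scaler_sumr; apply: eq_bigr => l _.
  rewrite scalerA -kmap_central -scalerA.
  have -> : ev (tgt a) *: m l = if nu l == tgt a then m l else 0.
    rewrite -{1}(m_span.1 l) scalerA class_ev -[path_src _]/(tgt a) eq_sym.
    by case: eqP => [<-|_]; rewrite ?scale0r //; apply: m_span.1.
  by case: eqP => // _; rewrite scaler0 kmap0 scale0r.
by rewrite (m_unique E) (negPf neq).
Qed.

Lemma amat_rel b a i j : Z b a -> \sum_l amat a i l * amat b l j = 0.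
Proof.
move=> ba; apply: (m_free (c := fun j => \sum_l amat a i l * amat b l j)).
transitivity (xa b *: (xa a *: m i)); last first.
  by rewrite scalerA (xa_rel B Zcomp ba) scale0r.
rewrite amatE scaler_sumr.
under [RHS]eq_bigr => l _ do
  rewrite scalerA -kmap_central -scalerA amatE scaler_sumr.
rewrite exchange_big; apply: eq_bigr => l _ /=.
rewrite kmap_sum scaler_suml; apply: eq_bigr => h _.
by rewrite scalerA -kmapM.
Qed.

(** A function [F] stands for the element of [A] tensor (chains of length [n])
    tensor [M] whose component at the chain [c] and the basis vector [m j] is
    [F (c, j)].  A chain is written like a path, its first arrow being the last
    entry.  The term of degree [n] of the Koszul complex is the submodule
    [kosz_set n], which imposes the compatibilities of a tensor product over the
    vertices. *)
Definition kosz n : lmodType A := {ffun n.-tuple Q1 * 'I_nb -> A^o}.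

Definition chain_at (s : seq Q1) j :=
  sorted Z s && (if s is a :: s' then src (last a s') == nu j else true).
Definition chain_tgt (s : seq Q1) j := if s is a :: _ then tgt a else nu j.
(** Right multiplication by this idempotent at every index is the projection onto
    the Koszul module. *)
Definition chain_idem s j : A := if chain_at s j then ev (chain_tgt s j) else 0.

Lemma chain_idemK s j : chain_idem s j * chain_idem s j = chain_idem s j.
Proof. by rewrite /chain_idem; case: ifP => _; rewrite ?mul0r ?ev_idem. Qed.

Lemma chain_at_cons b s j : chain_at (b :: s) j ->
  chain_at s j /\ src b = chain_tgt s j.
Proof.
case: s => [|a s]; rewrite /chain_at /=; first by move/eqP.
by move=> /andP[/andP[ba ->] ->]; split=> //; apply: Zcomp.
Qed.

Lemma chain_at_rcons s a i j : chain_at (rcons s a) i -> nu j = tgt a ->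
  [/\ nu i = src a, chain_at s j & chain_tgt s j = chain_tgt (rcons s a) i].
Proof.
rewrite /chain_at; case: s => [|b s] /=; first by move=> /eqP -> ->.
rewrite rcons_path last_rcons => /andP[/andP[-> ba] /eqP ->] ->.
by rewrite (Zcomp ba) eqxx.
Qed.

Section Degree.
Variable n : nat.
Let S : set (kosz n) := [set F : kosz n | forall x, (F x : A) * chain_idem x.1 x.2 = F x]%classic.
Lemma kosz_set0 : S 0. Proof. by move=> x; rewrite ffunE mul0r. Qed.
Lemma kosz_setD F G : S F -> S G -> S (F + G).
Proof. by move=> SF SG x; rewrite ffunE mulrDl SF SG. Qed.
Lemma kosz_setZ (c : A) F : S F -> S (c *: F).
Proof. by move=> SF x; rewrite ffunE -mulrA SF. Qed.
Definition kosz_set := Submodule kosz_set0 kosz_setD kosz_setZ.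
Lemma kosz_setP F : submod_set kosz_set F <->
  forall x, (F x : A) * chain_idem x.1 x.2 = F x.
Proof. by []. Qed.
End Degree.

Lemma kosz_off n (F : kosz n) (x : n.-tuple Q1 * 'I_nb) : submod_set (kosz_set n) F ->
  ~~ chain_at x.1 x.2 -> F x = 0.
Proof.
by move=> /kosz_setP/(_ x) <- xN; rewrite /chain_idem (negPf xN) mulr0.
Qed.

(** The two halves of the Koszul differential: the last arrow of a chain moves to
    the left, into [A], and its first arrow moves to the right, into [M]. *)
Definition kosz_l n (F : kosz n.+1) : kosz n :=
  [ffun x : n.-tuple Q1 * 'I_nb => \sum_b (F ([tuple of b :: x.1], x.2) : A) * xa b].
Definition kosz_r n (F : kosz n.+1) : kosz n :=
  [ffun x : n.-tuple Q1 * 'I_nb =>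
    \sum_a \sum_i (F ([tuple of rcons x.1 a], i) : A) * (amat a i x.2)%:A].

Lemma kosz_l_linear n : linear (@kosz_l n).
Proof.
move=> c F G; apply/ffunP => x; rewrite !ffunE scaler_sumr -big_split.
by apply: eq_bigr => b _; rewrite !ffunE /= mulrDl -mulrA.
Qed.
Lemma kosz_r_linear n : linear (@kosz_r n).
Proof.
move=> c F G; apply/ffunP => x; rewrite !ffunE scaler_sumr -big_split.
apply: eq_bigr => b _; rewrite scaler_sumr -big_split; apply: eq_bigr => i _.
by rewrite !ffunE /= mulrDl -mulrA.
Qed.

Lemma kosz_l_sub n (F : kosz n.+1) :
  submod_set (kosz_set _) F -> submod_set (kosz_set _) (kosz_l F).
Proof.
move=> SF; apply/kosz_setP => -[c j]; rewrite ffunE mulr_suml; apply: eq_bigr => b _ /=.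
have [bc|bcN] := boolP (chain_at (b :: c) j); last by rewrite (kosz_off SF) ?mul0r.
have [cj bE] := chain_at_cons bc.
by rewrite /chain_idem cj -bE -mulrA xa_ev eqxx.
Qed.

Lemma kosz_r_sub n (F : kosz n.+1) :
  submod_set (kosz_set _) F -> submod_set (kosz_set _) (kosz_r F).
Proof.
move=> SF; apply/kosz_setP => -[c j]; rewrite ffunE mulr_suml; apply: eq_bigr => a _ /=.
rewrite mulr_suml; apply: eq_bigr => i _.
have [ci|ciN] := boolP (chain_at (rcons c a) i); last by rewrite (kosz_off SF) ?mul0r.
have [->|/amat_supp[_ nj]] := eqVneq (amat a i j) 0; first by rewrite kmap0 mulr0 mul0r.
have [_ cj cE] := chain_at_rcons ci nj.
rewrite -mulrA kmap_central mulrA; congr (_ * _).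
have := (kosz_setP F).1 SF ([tuple of rcons c a], i).
by rewrite /chain_idem /= ci cj cE.
Qed.

(** Two neighbours in a chain multiply to zero, in [A] as well as on [M]. *)
Lemma kosz_ll n (F : kosz n.+2) : submod_set (kosz_set _) F -> kosz_l (kosz_l F) = 0.
Proof.
move=> SF; apply/ffunP => -[c j]; rewrite !ffunE big1 // => b _.
rewrite ffunE mulr_suml big1 // => b' _ /=.
have [bc|bcN] := boolP (chain_at (b' :: b :: c) j); last by rewrite (kosz_off SF) ?mul0r.
rewrite -mulrA (xa_rel B Zcomp) ?mulr0 //.
by move: bc => /andP[/= /andP[]].
Qed.

Lemma kosz_rr n (F : kosz n.+2) : submod_set (kosz_set _) F -> kosz_r (kosz_r F) = 0.
Proof.
move=> SF; apply/ffunP => -[c j]; rewrite !ffunE big1 // => a _.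
transitivity (\sum_a' \sum_i' (F ([tuple of rcons (rcons c a) a'], i') : A) *
   (\sum_i amat a' i' i * amat a i j)%:A).
  under eq_bigr => i _ do rewrite ffunE mulr_suml.
  rewrite exchange_big; apply: eq_bigr => a' _ /=.
  under eq_bigr => i _ do rewrite mulr_suml.
  rewrite exchange_big; apply: eq_bigr => i' _ /=.
  rewrite kmap_sum mulr_sumr; apply: eq_bigr => i _.
  by rewrite kmapM mulrA.
rewrite big1 // => a' _; rewrite big1 // => i' _.
have [ci|ciN] := boolP (chain_at (rcons (rcons c a) a') i'); last first.
  by rewrite (kosz_off SF) ?mul0r.
rewrite amat_rel ?kmap0 ?mulr0 //; move: ci => /andP[+ _] /=.
by rewrite -!cats1 -catA => /cat_sorted2[_ /= /andP[]].
Qed.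

Lemma kosz_lr n (F : kosz n.+2) : kosz_l (kosz_r F) = kosz_r (kosz_l F).
Proof.
apply/ffunP => -[c j]; rewrite !ffunE.
under eq_bigr => b _ do rewrite ffunE mulr_suml.
rewrite exchange_big; apply: eq_bigr => a _ /=.
under eq_bigr => b _ do rewrite mulr_suml.
rewrite exchange_big; apply: eq_bigr => i _ /=.
rewrite ffunE mulr_suml; apply: eq_bigr => b _ /=.
rewrite -!mulrA kmap_central; congr (F (_, _) * _).
exact: val_inj.
Qed.

(** The sign [(-1) ^+ n.+1] of the second half makes the mixed terms of the square
    cancel. *)
Definition kosz_d n (F : kosz n.+1) : kosz n := kosz_l F + iter n.+1 -%R (kosz_r F).

Lemma iter_opp_linear n (V : lmodType A) : linear (iter n -%R : V -> V).
Proof.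
move=> c x y; elim: n => //= n ->.
by rewrite opprD scalerN.
Qed.

Lemma kosz_d_linear n : linear (@kosz_d n).
Proof.
move=> c F G; rewrite /kosz_d kosz_l_linear kosz_r_linear iter_opp_linear.
by rewrite scalerDr addrACA.
Qed.

Lemma iter_opp_sub n (V : lmodType A) (U : submodule V) x :
  submod_set U x -> submod_set U (iter n -%R x).
Proof. by elim: n => //= n IH /IH Ux; rewrite -scaleN1r; apply: submodZ. Qed.

Lemma kosz_d_sub n (F : kosz n.+1) :
  submod_set (kosz_set _) F -> submod_set (kosz_set _) (kosz_d F).
Proof.
by move=> SF; apply: submodD; [apply: kosz_l_sub|apply/iter_opp_sub/kosz_r_sub].
Qed.

Lemma kosz_dd n (F : kosz n.+2) : submod_set (kosz_set _) F -> kosz_d (kosz_d F) = 0.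
Proof.
move=> SF; rewrite /kosz_d.
rewrite -[kosz_l _]/(linear_of (@kosz_l_linear _) _) linearD !linear_ofE.
rewrite -[kosz_r (_ + _)]/(linear_of (@kosz_r_linear _) _) linearD !linear_ofE.
have lN h G : kosz_l (iter h -%R G) = iter h -%R (kosz_l G) :> kosz n.
  elim: h => //= h IH; rewrite -IH.
  by rewrite -[kosz_l (- _)]/(linear_of (@kosz_l_linear _) _) linearN.
have rN h G : kosz_r (iter h -%R G) = iter h -%R (kosz_r G) :> kosz n.
  elim: h => //= h IH; rewrite -IH.
  by rewrite -[kosz_r (- _)]/(linear_of (@kosz_r_linear _) _) linearN.
rewrite lN rN kosz_ll // kosz_rr // kosz_lr add0r.
have -> h : iter h -%R 0 = 0 :> kosz n by elim: h => //= h ->; rewrite oppr0.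
by rewrite addr0 /= addNr.
Qed.

(** Moves the first arrow of a path in [A] to the chain, when this gives a relation
    chain.  It is not linear over [A]. *)
Definition kosz_s n (F : kosz n) : kosz n.+1 :=
  [ffun x : n.+1.-tuple Q1 * 'I_nb => if chain_at x.1 x.2 then
     strip (thead x.1) (F ([tuple of behead x.1], x.2)) else 0].

Lemma kosz_s_sub n (F : kosz n) :
  submod_set (kosz_set _) F -> submod_set (kosz_set _) (kosz_s F).
Proof.
move=> SF; apply/kosz_setP => -[c j]; rewrite ffunE /chain_idem /=.
case: ifP => _; last by rewrite mulr0.
by rewrite (tuple_eta c) /= theadE strip_ev.
Qed.

(** For the first half of the differential alone, [kosz_s] is a contracting
    homotopy in positive degrees; this is [xa_syzygy]. *)
Lemma kosz_homotopy n (F : kosz n.+1) : submod_set (kosz_set _) F ->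
  F = kosz_l (kosz_s F) + kosz_s (kosz_l F).
Proof.
move=> SF; apply/ffunP => -[c j]; case/tupleP: c => a c; rewrite !ffunE /=.
have [ac|acN] := boolP (chain_at (a :: c) j); last first.
  rewrite addr0 (kosz_off SF) // big1 // => b _; rewrite ffunE /=.
  case: ifP => [/chain_at_cons[ac _]|_]; last by rewrite mul0r.
  by rewrite ac in acN.
have <- := (kosz_setP F).1 SF ([tuple of a :: c], j).
rewrite /chain_idem /= ac /chain_tgt (xa_syzygy B normal_length Zcomp); congr (_ + _).
  rewrite big_mkcond; apply: eq_bigr => b _; rewrite ffunE /= theadE.
  have -> : chain_at [:: b, a & c] j = Z b a.
    move: ac; rewrite /chain_at /=.
    by case: (Z b a).
  case: ifP => _; last by rewrite mul0r.
  congr (strip b (F _) * _); congr pair; exact: val_inj.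
rewrite theadE strip_sum (bigD1 a) //= big1 ?addr0 => [|b ba]; last exact: strip_xa_neq.
congr (strip a (F _ * _)); congr pair; exact: val_inj.
Qed.

(** The filtration by lengths of paths: [kosz_l] raises them by one, [kosz_s] lowers
    them by one and [kosz_r] preserves them. *)
Definition kosz_fil L n (F : kosz n) :=
  forall x p, (L <= path_length p)%N -> coef p (F x) = 0.

Lemma kosz_filD L n (F G : kosz n) : kosz_fil L F -> kosz_fil L G -> kosz_fil L (F + G).
Proof. by move=> fF fG x p Lp; rewrite ffunE coefD fF // fG // addr0. Qed.

Lemma kosz_filN L n h (F : kosz n) : kosz_fil L F -> kosz_fil L (iter h -%R F).
Proof.
by elim: h => //= h IH /IH fF x p Lp; rewrite ffunE coefN fF // oppr0.
Qed.

Lemma kosz_fil_r L n (F : kosz n.+1) : kosz_fil L F -> kosz_fil L (kosz_r F).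
Proof.
move=> fF x p Lp; rewrite ffunE coef_sum big1 // => a _.
by rewrite coef_sum big1 // => i _; rewrite -kmap_central coefZ fF ?mulr0.
Qed.

Lemma kosz_fil_s L n (F : kosz n) : kosz_fil L.+1 F -> kosz_fil L (kosz_s F).
Proof.
move=> fF x p Lp; rewrite ffunE; case: ifP => _; last exact: coef0.
rewrite /strip_arrow coef_sum big1 // => q /eqP qb; rewrite coefZ coef_cl.
case: (p =P q) => [pq|_]; last by rewrite andbF mulr0.
by rewrite fF ?mul0r // path_rcons_length // -pq.
Qed.

Lemma kosz_fil_max n (F : kosz n) : kosz_fil N.+1 F.
Proof.
move=> x p Np; apply/eqP/negPn/negP => /coef_normal/normal_length.
by rewrite leqNgt Np.
Qed.

Lemma kosz_fil0 n (F : kosz n) : kosz_fil 0 F -> F = 0.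
Proof. by move=> fF; apply/ffunP => x; rewrite ffunE; apply: coef_eq0 => p; apply: fF. Qed.

(** The homotopy identity for [kosz_l] fails for the whole differential only by
    terms with shorter paths; iterating, every cycle is a boundary. *)
Lemma kosz_step L n (F : kosz n.+1) : submod_set (kosz_set _) F -> kosz_d F = 0 ->
  kosz_fil L.+1 F -> kosz_fil L (F - kosz_d (kosz_s F)).
Proof.
move=> SF dF fF; rewrite {1}(kosz_homotopy SF) /kosz_d opprD addrACA subrr add0r.
have lF : kosz_l F = iter n.+2 -%R (kosz_r F).
  by apply/eqP; rewrite -addr_eq0; apply/eqP.
apply: kosz_filD; first by rewrite lF; apply/kosz_fil_s/kosz_filN/kosz_fil_r.
by apply: (@kosz_filN L _ n.+3); apply/kosz_fil_r/kosz_fil_s.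
Qed.

Lemma kosz_exact n (F : kosz n.+1) : submod_set (kosz_set _) F -> kosz_d F = 0 ->
  exists2 G, submod_set (kosz_set n.+2) G & F = kosz_d G.
Proof.
have := @kosz_fil_max _ F; move: N.+1 => L.
elim: L F => [|L IH] F fF SF dF.
  exists 0; first exact: submod0.
  by rewrite -[kosz_d 0]/(linear_of (@kosz_d_linear _) 0) linear0; apply: kosz_fil0.
have SsF := kosz_s_sub SF.
have [||G SG GE] := IH _ (kosz_step SF dF fF).
- by rewrite -scaleN1r; apply: submodD => //; apply/submodZ/kosz_d_sub.
- rewrite -[kosz_d _]/(linear_of (@kosz_d_linear _) _) linearB !linear_ofE dF.
  by rewrite kosz_dd // subr0.
exists (G + kosz_s F); first exact: submodD.
by rewrite -[kosz_d _]/(linear_of (@kosz_d_linear _) _) linearD !linear_ofE -GE subrK.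
Qed.

Definition kosz_eps (F : kosz 0) : M := \sum_j (F ([tuple], j) : A) *: m j.

Lemma kosz_eps_linear : linear kosz_eps.
Proof.
move=> c F G; rewrite /kosz_eps scaler_sumr -big_split; apply: eq_bigr => j _.
by rewrite !ffunE /= scalerDl scalerA.
Qed.

Lemma kosz_eps_surj x : exists2 F, submod_set (kosz_set 0) F & kosz_eps F = x.
Proof.
exists [ffun y : 0.-tuple Q1 * 'I_nb => (coord x y.2)%:A * ev (nu y.2)].
  apply/kosz_setP => -[c j]; rewrite !ffunE (tuple0 c) /chain_idem /=.
  by rewrite -mulrA ev_idem.
rewrite /kosz_eps [RHS]coordE; apply: eq_bigr => j _.
by rewrite ffunE /= -scalerA m_span.1.
Qed.

Lemma kosz_eps_d (F : kosz 1) : submod_set (kosz_set 1) F -> kosz_eps (kosz_d F) = 0.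
Proof.
move=> SF; rewrite /kosz_eps.
under eq_bigr => j _ do rewrite ffunE /= [X in _ + X]ffunE scalerDl scaleNr.
rewrite big_split /= sumrN; apply/eqP; rewrite subr_eq0; apply/eqP.
transitivity (\sum_b \sum_j (F ([tuple b], j) : A) *: (xa b *: m j)).
  rewrite exchange_big; apply: eq_bigr => j _; rewrite ffunE scaler_suml.
  apply: eq_bigr => b _; rewrite scalerA; congr (F (_, _) * _ *: _); exact: val_inj.
under [RHS]eq_bigr => j _ do rewrite ffunE scaler_suml.
rewrite [RHS]exchange_big; apply: eq_bigr => b _ /=.
under [RHS]eq_bigr => j _ do rewrite scaler_suml.
rewrite [RHS]exchange_big; apply: eq_bigr => j _ /=.
rewrite amatE scaler_sumr; apply: eq_bigr => l _; rewrite scalerA.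
by congr (F (_, _) * _ *: _); apply: val_inj.
Qed.

(** In degree 0 the homotopy identity misses the multiples of the vertices; on
    these the augmentation is injective, because the [m j] form a basis. *)
Lemma kosz_exact0 (F : kosz 0) : submod_set (kosz_set 0) F -> kosz_eps F = 0 ->
  exists2 G, submod_set (kosz_set 1) G & F = kosz_d G.
Proof.
(* The part of [F] supported on paths of length 0. *)
pose top (F : kosz 0) : kosz 0 := [ffun x =>
  (coef (vertex_path (nu x.2)) (F x))%:A * ev (nu x.2)].
have topE (G : kosz 0) : submod_set (kosz_set 0) G -> G = top G + kosz_l (kosz_s G).
  move=> SG; apply/ffunP => -[c j]; rewrite !ffunE (tuple0 c) /=.
  have := (kosz_setP G).1 SG ([tuple], j); rewrite /chain_idem /= => Gj.
  have D := ev_xa_decomp B normal_length (G ([tuple], j)).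
  rewrite -[LHS]Gj {1}D mulrDl; congr (_ + _).
    rewrite mulr_suml (bigD1 (nu j)) //= big1 ?addr0 => [|v vj].
      by rewrite -mulrA ev_idem.
    rewrite -mulrA class_ev -[path_src _]/v (negPf vj) mulr0.
    by [].
  rewrite mulr_suml; apply: eq_bigr => b _; rewrite ffunE /= /chain_at /=.
  rewrite -mulrA xa_ev; case: ifP => _; rewrite ?mulr0 ?mul0r //.
  rewrite theadE.
  congr (strip b (G _) * _); congr pair; exact: val_inj.
have top_fil G : kosz_fil 1 (top G).
  move=> x p p1; rewrite ffunE coefZ coef_cl; case: eqP => [pE|_].
    by rewrite pE in p1.
  by rewrite andbF mulr0.
have := @kosz_fil_max _ F; move: N => L.
elim: L F => [|L IH] F fF SF eF.
  have FE : F = top F.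
    rewrite {1}(topE F SF); suff -> : kosz_s F = 0.
      by rewrite -[kosz_l 0]/(linear_of (@kosz_l_linear _) 0) linear0 addr0.
    exact/kosz_fil0/kosz_fil_s.
  exists 0; first exact: submod0.
  rewrite -[kosz_d 0]/(linear_of (@kosz_d_linear _) 0) linear0.
  have c0 : forall j, coef (vertex_path (nu j)) (F ([tuple], j)) = 0.
    apply: m_free; rewrite -[RHS]eF /kosz_eps; apply: eq_bigr => j _.
    by rewrite [in RHS]FE ffunE /= -scalerA m_span.1.
  by rewrite FE; apply/ffunP => -[c j]; rewrite !ffunE (tuple0 c) /= c0 kmap0 mul0r.
have SsF := kosz_s_sub SF.
have [|||G SG GE] := IH (F - kosz_d (kosz_s F)).
- rewrite {1}(topE F SF) [top F + _]addrC /kosz_d opprD addrACA subrr add0r.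
  apply: kosz_filD; first by move=> x p Lp; apply: top_fil; apply: leq_trans Lp.
  by apply: (@kosz_filN L.+1 _ 2); apply/kosz_fil_r/kosz_fil_s.
- by rewrite -scaleN1r; apply: submodD => //; apply/submodZ/kosz_d_sub.
- rewrite -[kosz_eps _]/(linear_of kosz_eps_linear _) linearB !linear_ofE eF.
  by rewrite kosz_eps_d // subr0.
exists (G + kosz_s F); first exact: submodD.
by rewrite -[kosz_d _]/(linear_of (@kosz_d_linear _) _) linearD !linear_ofE -GE subrK.
Qed.

Definition kosz_mod n : lmodType A := submod_type (kosz_set n).

Definition kosz_gen n (x : n.-tuple Q1 * 'I_nb) : kosz n :=
  [ffun y => if y == x then chain_idem x.1 x.2 else 0].
Lemma kosz_gen_sub n x : submod_set (kosz_set n) (kosz_gen x).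
Proof.
apply/kosz_setP => y; rewrite ffunE; case: eqP => [->|_]; last by rewrite mul0r.
exact: chain_idemK.
Qed.
Definition kosz_genE n x : kosz_mod n := submod_elt (kosz_gen_sub x).

Lemma kosz_coord_linear n x : linear (fun F : kosz_mod n => val F x : A^o).
Proof. by move=> c F G; rewrite linearP !ffunE. Qed.

Lemma kosz_dual_basis n (F : kosz_mod n) :
  F = \sum_x (linear_of (kosz_coord_linear x) F : A) *: kosz_genE x.
Proof.
have vZ c (G : kosz_mod n) y : (val (c *: G)) y = c * (val G y) by rewrite ffunE.
apply: val_inj; rewrite linear_sum; apply/ffunP => y; rewrite sum_ffunE (bigD1 y) //.
rewrite big1 ?addr0 => [|x xy]; last by rewrite vZ ffunE eq_sym (negPf xy) mulr0.
rewrite vZ ffunE eqxx [RHS]addr0; exact: (esym ((kosz_setP _).1 (submod_valP F) y)).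
Qed.

Lemma kosz_projective n : projective_module (kosz_mod n).
Proof. exact: dual_basis_projective (@kosz_dual_basis n). Qed.

Lemma kosz_fin_dim n : fin_dim (kosz_mod n).
Proof.
apply: (@fin_dim_generated _ _ _ _ (@kosz_genE n) (fin_dim_regular B normal_length)) => F.
by exists (fun x => linear_of (kosz_coord_linear x) F); apply: kosz_dual_basis.
Qed.

Lemma kosz_dm_sub n (F : kosz_mod n.+1) :
  submod_set (kosz_set n) ((linear_of (@kosz_d_linear n) \o submod_incl _) F).
Proof. exact/kosz_d_sub/submod_valP. Qed.
Definition kosz_dm n : {linear kosz_mod n.+1 -> kosz_mod n} := corestrict (@kosz_dm_sub n).

Definition kosz_epsm : {linear kosz_mod 0 -> M} := linear_of kosz_eps_linear \o submod_incl _.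

Lemma kosz_resolution d : (forall s, sorted Z s -> (size s <= d)%N) -> projdim_le M d.
Proof.
move=> Zd; exists kosz_mod, kosz_dm, kosz_epsm; split.
- by move=> n; split; [apply: kosz_fin_dim|apply: kosz_projective].
- move=> n F dn; apply: val_inj; apply/ffunP => x; rewrite ffunE.
  apply: (kosz_off (submod_valP F)); apply/negP => /andP[/Zd].
  by rewrite size_tuple leqNgt dn.
- by move=> x; have [F SF <-] := kosz_eps_surj x; exists (submod_elt SF).
- move=> F; split=> [/(kosz_exact0 (submod_valP F))[G SG FE]|[G ->]].
    by exists (submod_elt SG); apply: val_inj.
  exact: kosz_eps_d (submod_valP G).
move=> n F; split=> [/(congr1 val)/(kosz_exact (submod_valP F))[G SG FE]|[G ->]].
  by exists (submod_elt SG); apply: val_inj.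
by apply: val_inj; apply: kosz_dd (submod_valP G).
Qed.

End KoszulComplex.

Lemma gldim_le_relation_chains (k : fieldType) (Q : quiver) (Z : rel (arrow Q)) (A : pzAlgType k)
    (B : monomial_basis Z A) (N d : nat) :
  (forall p, normal Z p -> path_length p <= N) ->
  (forall b a, Z b a -> src b = tgt a) ->
  (forall s, sorted Z s -> size s <= d) -> gldim_le A d.
Proof.
move=> normal_length Zcomp Zd M fM.
have [n [m [nu [m_span m_free]]]] := homogeneous_basis_exists B fM.
exact: (@kosz_resolution _ _ _ _ B N normal_length Zcomp M n m nu m_span m_free d Zd).
Qed.

(** * Projective covers and standard modules *)
Section ProjectiveCovers.
Local Open Scope ring_scope.
Context {k : fieldType} {Q : quiver} (Z : rel (arrow Q)).
Context {A : pzAlgType k}.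
Variable B : monomial_basis Z A.
Variable N : nat.
Hypothesis normal_length : forall p, normal Z p -> (path_length p <= N)%N.
Hypothesis Zcomp : forall b a, Z b a -> src b = tgt a.
Local Notation cl := (basis_elt B).
Local Notation coef := (basis_coef B).
Local Notation ev := (vertex_elt B).
Local Notation xa := (arrow_elt B).
Local Notation strip := (strip_arrow B N).
Local Notation arrows_set := (arrows_set B).
Implicit Types (p q r : qpath Q) (a b : arrow Q) (i j : vertex Q).

(** Every path in such a left ideal has positive length. *)
Lemma coef_vertex_arrows P z j : submod_set (arrows_set P) z -> coef (vertex_path j) z = 0.
Proof.
move=> [y ->]; rewrite coef_sum big1 // => b _.
refine (@coef_ind _ _ _ _ B (fun x => coef _ (x * xa b) = 0) (y b) _ _ _).
- by rewrite mul0r coef0.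
- by move=> c u v u0 v0; rewrite mulrDl -mulrA coefP u0 v0 mulr0 addr0.
move=> p _; rewrite cl_mul; case: eqP => [pb|_]; last exact: coef0.
rewrite coef_cl; case: eqP => [/(congr1 path_arrows)|_]; last by rewrite andbF.
by rewrite (path_rcons_arrows pb); case: (path_arrows p).
Qed.

Variable i : vertex Q.

(** Split off the multiple of [e_i]; the other paths from [i] have positive length,
    hence lie in the radical. *)
Lemma proj_mod_top (x : proj_mod B i) : exists2 y : proj_mod B i,
  submod_set (rad_proj B i) y &
  x = (kmap (coef (vertex_path i) (val x)) : A) *: proj_gen B i + y.
Proof.
set c := coef _ _; pose y := x - (kmap c : A) *: proj_gen B i.
exists y; last by rewrite addrC subrK.
change (submod_set (arrows_set (fun b => src b == i)) (val y)).
have xE : val x = kmap c * ev i + \sum_(b | src b == i) strip b (val x) * xa b :> A.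
  rewrite -{1}(proj_modP x) {1}(ev_xa_decomp B normal_length (val x)) mulrDl.
  congr (_ + _).
    rewrite mulr_suml (bigD1 i) //= -mulrA ev_idem big1 ?addr0 // => v vi.
    by rewrite -mulrA class_ev -[path_src _]/v (negPf vi) mulr0.
  rewrite mulr_suml [RHS]big_mkcond; apply: eq_bigr => b _.
  by rewrite -mulrA xa_ev; case: ifP => _; rewrite ?mulr0.
have yE : val y = \sum_(b | src b == i) strip b (val x) * xa b :> A.
  by rewrite -[val y]/((val x : A) - kmap c * ev i) {1}xE addrC addKr.
by rewrite yE; exists (fun b => strip b (val x)).
Qed.

Lemma proj_gen_notin_rad : ~ submod_set (rad_proj B i) (proj_gen B i).
Proof.
move=> /(coef_vertex_arrows i) /=; rewrite coef_cl !eqxx => /eqP.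
by rewrite oner_eq0.
Qed.

Lemma simple_modP : exists v : simple_mod B i,
  [/\ v <> 0, forall x, exists c : k, x = (kmap c : A) *: v,
      ev i *: v = v & forall a, xa a *: v = 0].
Proof.
exists (quot_map (rad_proj B i) (proj_gen B i)); split.
- by move=> /quot_mapP/proj_gen_notin_rad.
- move=> x; have [y <-] := quot_map_surj x.
  have [z zR yE] := proj_mod_top y; exists (coef (vertex_path i) (val y)).
  have z0 : quot_map (rad_proj B i) z = 0 by apply/quot_mapP.
  by rewrite {1}yE linearP z0 addr0.
- rewrite -linearZZ; congr (quot_map _ _); apply: val_inj.
  by rewrite linearZ /=; apply: ev_idem.
move=> a; rewrite -linearZZ; apply/quot_mapP.
change (submod_set (arrows_set (fun b => src b == i)) (xa a * ev i)).
rewrite xa_ev; case: ifP => [ai|_]; last exact: submod0.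
by rewrite -[xa a]mul1r; apply: arrows_setM.
Qed.

(** Nakayama's lemma for [A e_i].  Write [e_i = u + v] with [u] in [U] and [v] in
    the radical.  A path [p] from [i] equals [p u + p v], and [p v] is a combination
    of longer paths; so all of the paths belong to [U], by descending induction on
    their length. *)
Lemma rad_superfluous (U : submodule (proj_mod B i)) :
  (forall x, exists u v, [/\ submod_set U u, submod_set (rad_proj B i) v & x = u + v]) ->
  forall x, submod_set U x.
Proof.
move=> Urad; pose W (z : A) := exists2 x : proj_mod B i, submod_set U x & val x = z.
have W0 : W 0 by exists 0; first exact: submod0.
have WD y z : W y -> W z -> W (y + z).
  by move=> [x Ux <-] [x' Ux' <-]; exists (x + x'); first exact: submodD.
have WM y z : W z -> W (y * z).
  by move=> [x Ux <-]; exists (y *: x); first exact: submodZ.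
have [u [v [Uu Rv uvE]]] := Urad (proj_gen B i).
have Wp n p : path_src p = i -> (N < n + path_length p)%N -> W (cl p).
  elim: n p => [|n IH] p pi Np.
    by rewrite cl_not_normal //; apply/negP => /normal_length; rewrite leqNgt Np.
  have -> : cl p = cl p * val u + cl p * val v.
    rewrite -mulrDr; have /(congr1 val)/= <- := uvE.
    by rewrite class_ev pi eqxx.
  apply: (WD _ _ (WM _ (val u) _)) => //; first by exists u.
  have [y ->] := Rv; rewrite mulr_sumr.
  apply: (big_ind W W0 WD) => b /eqP bi.
  refine (@coef_ind _ _ _ _ B (fun y => W (cl p * (y * xa b))) (y b) _ _ _).
  - by rewrite mul0r mulr0.
  - move=> c s t Ws Wt; rewrite mulrDl mulrDr -mulrA mulrA -kmap_central -mulrA.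
    exact/WD/Wt/WM.
  move=> q _; rewrite cl_mul; case: eqP => [qb|_]; last by rewrite mulr0.
  rewrite cl_mul; case: eqP => [pq|_]; last by [].
  have qb' : path_tgt (path_cat q (arrow_path b)) = path_tgt q by rewrite path_cat_tgt.
  apply: (IH) => //; first by rewrite !path_cat_src.
  rewrite /path_length !path_cat_arrows // !size_cat /= addn1 -/(path_length p).
  by apply: leq_trans Np _; rewrite addSn -addnS leq_add2l addnS ltnS leq_addr.
have Wi : W (ev i) by apply: (Wp N.+1) => //; rewrite addSn ltnS leq_addr.
move=> x; have [x' Ux' x'E] := WM (val x) _ Wi.
by rewrite -(_ : x' = x) //; apply: val_inj; rewrite x'E; apply: proj_modP.
Qed.

Lemma proj_mod_cover : projective_cover (quot_map (rad_proj B i)).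
Proof.
split; [exact: proj_mod_projective|exact: quot_map_surj|move=> U UE].
apply: rad_superfluous => x; have [u [v [Uu /quot_mapP Rv ->]]] := UE x.
by exists u, v.
Qed.

End ProjectiveCovers.

Section StandardModules.
Local Open Scope ring_scope.
Context {k : fieldType} {Q : quiver} (Z : rel (arrow Q)).
Context {A : pzAlgType k}.
Variable B : monomial_basis Z A.
Variable N : nat.
Hypothesis normal_length : forall p, normal Z p -> (path_length p <= N)%N.
Hypothesis Zcomp : forall b a, Z b a -> src b = tgt a.
Variable lab : vertex Q -> nat.
Definition goes_up a := (lab (src a) < lab (tgt a))%N.
Definition goes_down a := (lab (tgt a) < lab (src a))%N.
Local Notation up := goes_up.
Local Notation down := goes_down.
Hypothesis up_or_down : forall a, up a || down a.
Hypothesis Zup : forall b a, Z b a -> up a.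
Hypothesis Zdown : forall b a, src b = tgt a -> up a -> down b -> Z b a.
Local Notation cl := (basis_elt B).
Local Notation coef := (basis_coef B).
Local Notation ev := (vertex_elt B).
Local Notation xa := (arrow_elt B).
Local Notation strip := (strip_arrow B N).
Local Notation arrows_set := (arrows_set B).
Implicit Types (p q r : qpath Q) (a b : arrow Q) (i j : vertex Q).

Lemma up_not_down a : up a -> ~~ down a.
Proof. by rewrite /goes_up /goes_down -leqNgt; apply: ltnW. Qed.

(** An arrow going up cannot be followed by an arrow going down. *)
Lemma normal_up p b : path_src p = tgt b -> up b -> normal Z (path_rcons p b) ->
  (lab (src b) < lab (path_tgt p))%N.
Proof.
elim/(@qpath_rcons_ind Q): p b => [i|p c pc IH] b.
  by move=> ib ub _; rewrite -[path_tgt _]/(path_src (vertex_path i)) ib.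
rewrite path_rcons_src // path_rcons_tgt // => cb ub.
rewrite normal_rcons2 // => /andP[pn cbN].
have cu : up c.
  by case/orP: (up_or_down c) => // /(Zdown cb ub); rewrite (negPf cbN).
by apply: leq_trans (IH c pc cu pn); rewrite cb -ltnS ltnW.
Qed.

Variable i : vertex Q.
Definition down_from b := (src b == i) && down b.
(** The submodule generated by the arrows going down; the quotient by it is the
    standard module. *)
Definition std_kernel : submodule (proj_mod B i) := submod_in (arrows_set down_from) (proj_set B i).
Definition std_mod : lmodType A := quot_mod std_kernel.

(** Modulo the arrows going down, a path of positive length goes up all the way. *)
Lemma ev_rad_std j (x : proj_mod B i) : (lab j <= lab i)%N ->
  submod_set (rad_proj B i) x -> submod_set std_kernel (ev j *: x).
Proof.
move=> ji [y yE]; change (submod_set (arrows_set down_from) (ev j * val x)).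
rewrite yE mulr_sumr.
have S0 := submod0 (arrows_set down_from).
have SD := @submodD _ _ (arrows_set down_from).
apply: (big_ind _ S0 SD) => b /eqP bi; rewrite mulrA.
case/orP: (up_or_down b) => [ub|db]; last by apply: arrows_setM; rewrite /down_from bi eqxx.
suff -> : ev j * y b * xa b = 0 by [].
refine (@coef_ind _ _ _ _ B (fun z => ev j * z * xa b = 0) (y b) _ _ _).
- by rewrite mulr0 mul0r.
- move=> c u v u0 v0; rewrite mulrDr mulrDl v0 addr0 [ev j * _]mulrA.
  by rewrite -kmap_central -!mulrA [ev j * _]mulrA u0 mulr0.
move=> p _; rewrite ev_class; case: (eqVneq j (path_tgt p)) => [jp|_]; last by rewrite mul0r.
have [pb|pb] := eqVneq (path_src p) (tgt b); last by rewrite class_xa0 //; apply/eqP.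
rewrite class_xa // cl_not_normal //; apply/negP => /(normal_up pb ub).
by rewrite -jp bi ltnNge ji.
Qed.

Let J : set std_mod := [set x | exists2 y : proj_mod B i,
  submod_set (rad_proj B i) y & quot_map std_kernel y = x]%classic.
Lemma std_rad0 : J 0.
Proof. by exists 0; [apply: submod0|apply: linear0]. Qed.
Lemma std_radD x y : J x -> J y -> J (x + y).
Proof.
move=> [u Ru <-] [v Rv <-]; exists (u + v); first exact: submodD.
exact: linearD.
Qed.
Lemma std_radZ (c : A) x : J x -> J (c *: x).
Proof.
move=> [u Ru <-]; exists (c *: u); first exact: submodZ.
exact: linearZZ.
Qed.
(** The image of the radical of [A e_i].  It is a maximal submodule, and therefore
    contains the radical of the standard module. *)
Definition std_rad := Submodule std_rad0 std_radD std_radZ.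

Lemma std_kernel_rad x : submod_set std_kernel x -> submod_set (rad_proj B i) x.
Proof. by apply: arrows_setS => b /andP[]. Qed.

Lemma std_rad_maximal : submod_maximal std_rad.
Proof.
split=> [all|V JV].
  have [y Ry /qclassP] := all (quot_map std_kernel (proj_gen B i)).
  move=> /std_kernel_rad Rd; apply: (@proj_gen_notin_rad _ _ _ _ B i).
  rewrite -[proj_gen B i](subKr y); apply: submodD => //.
  by rewrite -scaleN1r; apply: submodZ.
have [[x [Vx Jx]]|nV] := pselect (exists x, submod_set V x /\ ~ submod_set std_rad x); last first.
  left=> x Vx; have [//|Jx] := pselect (submod_set std_rad x).
  by case: nV; exists x.
right; have [y yE] := quot_map_surj x.
have [z Rz] := proj_mod_top normal_length y.
set c := basis_coef B _ _ => yz.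
have c0 : c != 0.
  apply/eqP => c0; apply: Jx; exists z => //.
  by rewrite -yE yz c0 kmap0 scale0r add0r.
have Vgen : submod_set V (quot_map std_kernel (proj_gen B i)).
  have -> : proj_gen B i = (kmap c^-1 : A) *: (y - z).
    by rewrite {1}yz addrK scalerA -kmapM mulVf // kmap1 scale1r.
  rewrite linearZZ linearB yE; apply: submodZ; apply: submodD => //.
  by rewrite -scaleN1r; apply: submodZ; apply: JV; exists z.
move=> x'; have [y' <-] := quot_map_surj x'.
by rewrite [y']proj_gen_basis linearZZ; apply: submodZ.
Qed.

(** Lift [v] to an element [w] of the radical; then [e_j w] also lifts [v], so it is
    nonzero.  By [ev_rad_std], this forces [j] to have a larger label. *)
Lemma std_rad_composition_factor j (S : lmodType A) (v : S) :
  v <> 0 -> ev j *: v = v -> composition_factor (submod_type (radical std_mod)) S ->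
  (lab i < lab j)%N.
Proof.
move=> v0 vj [_ [r [F [_ [l _ [_ [f [fS fker]]]]]]]]; rewrite ltnNge; apply/negP => ji.
have [w wv] := fS v; apply: v0; rewrite -vj -wv -linearZZ; apply/fker.
have -> : val (ev j *: w) = 0.
  apply: val_inj; change (ev j *: val (val w) = 0 :> std_mod).
  have [y Ry <-] : submod_set std_rad (val (val w)).
    exact: (submod_valP (val w)) std_rad_maximal.
  by rewrite -linearZZ; apply/quot_mapP/ev_rad_std.
exact: submod0.
Qed.

Section DirectSum.
Let D : pred (arrow Q) := down_from.
Let ar (l : 'I_#|D|) : arrow Q := enum_val l.

Lemma ar_down l : down_from (ar l). Proof. exact: (enum_valP l). Qed.

Lemma xa_mult_sub l x : submod_set (proj_set B i) (linear_of (@xa_cover_linear _ _ _ _ B (ar l)) x).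
Proof. by have /andP[ai _] := ar_down l; rewrite /= -mulrA xa_ev ai. Qed.
Lemma xa_mult_sub' l x : submod_set std_kernel (corestrict (@xa_mult_sub l) x).
Proof. by apply: arrows_setM; apply: ar_down. Qed.

(** Right multiplication by an arrow [a] going down is injective on [A e_(t a)],
    because no relation starts with [a]. *)
Lemma std_kernel_direct_sum : is_direct_sum (submod_type std_kernel)
  (fun l : 'I_#|D| => proj_mod B (tgt (ar l))).
Proof.
pose iota l : {linear proj_mod B (tgt (ar l)) -> submod_type std_kernel} :=
  corestrict (@xa_mult_sub' l).
have iotaE (y : forall l, proj_mod B (tgt (ar l))) :
    val (val (\sum_l iota l (y l))) = \sum_l (val (y l) : A) * xa (ar l) :> A.
  by rewrite !linear_sum.
exists iota; split=> [x|y /(congr1 (val \o val))/= y0 l].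
  have yP l : submod_set (proj_set B (tgt (ar l))) (strip (ar l) (val (val x))).
    exact: strip_ev.
  exists (fun l => submod_elt (yP l)); apply/val_inj/val_inj.
  rewrite [RHS]iotaE.
  transitivity (\sum_(b | D b) strip b (val (val x)) * xa b).
    exact/(arrows_setP B normal_length Zcomp)/(submod_valP x).
  exact: (big_enum_val (A := D) (fun b => strip b (val (val x)) * xa b)).
have {y0} : \sum_l (val (y l) : A) * xa (ar l) = 0 by rewrite -iotaE.
move=> /(congr1 (strip (ar l))); rewrite strip0 strip_sum (bigD1 l) //= big1 ?addr0; last first.
  move=> l' l'l; apply: strip_xa_neq => //.
  by apply: contra_neq l'l => /enum_val_inj.
have /andP[_ dl] := ar_down l.
have := xa_syzygy B normal_length Zcomp (ar l) (val (y l)).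
rewrite big1 ?add0r => [<-|b /Zup ul]; last by have := up_not_down ul; rewrite dl.
by rewrite (proj_modP (y l)) => yl; apply: val_inj.
Qed.
End DirectSum.

End StandardModules.

(** * Admissibility of monomial ideals *)
Section IdealArithmetic.
Local Open Scope ring_scope.
Context {k : fieldType} {Q : quiver}.
Local Notation kQ := (path_algebra k Q).
Implicit Types (f g : kQ) (p q r : qpath Q) (a b : arrow Q).

Lemma path_elt_cat p q : path_src p = path_tgt q ->
  path_elt (path_cat p q) = path_elt p * path_elt q :> kQ.
Proof. by move=> pq; rewrite -[RHS]/(kQ_mul _ _) kQ_mul_elt /path_mul pq eqxx. Qed.

Lemma scale_kmap c f : c *: f = kmap c * f.
Proof. by rewrite -[RHS]/(kQ_mul _ _) kQ_mulZl kQ_mul1l. Qed.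

Lemma ideal_gen_sub (S : set kQ) f : S f -> ideal_gen S f.
Proof. by move=> Sf J; apply. Qed.

Lemma ideal_mulD (I J : set kQ) f g : ideal_mul I J f -> ideal_mul I J g -> ideal_mul I J (f + g).
Proof.
move=> [n [a [b [Ia [Jb ->]]]]] [n' [a' [b' [Ia' [Jb' ->]]]]].
pose u (i : 'I_(n + n')) := match split i with inl j => a j | inr j => a' j end.
pose v (i : 'I_(n + n')) := match split i with inl j => b j | inr j => b' j end.
exists (n + n')%N, u, v; split; first by move=> i; rewrite /u; case: split.
split; first by move=> i; rewrite /v; case: split.
have ul i : split (lshift n' i) = inl i := unsplitK (inl i).
have ur i : split (rshift n i) = inr i := unsplitK (inr i).
rewrite big_split_ord /=; congr (_ + _); apply: eq_bigr => i _.
  by rewrite /u /v ul.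
by rewrite /u /v ur.
Qed.

Lemma ideal_mul_elt (I J : set kQ) f g : I f -> J g -> ideal_mul I J (f * g).
Proof.
move=> If Jg; exists 1%N, (fun=> f), (fun=> g); do 2!split=> //.
by rewrite big_ord1.
Qed.

Lemma ideal_mulZ (I J : set kQ) c f :
  (forall g, I g -> I (c *: g)) -> ideal_mul I J f -> ideal_mul I J (c *: f).
Proof.
move=> IZ [n [a [b [Ia [Jb ->]]]]]; exists n, (fun i => c *: a i), b.
split; first by move=> i; apply: IZ.
split=> //; rewrite scaler_sumr; apply: eq_bigr => i _.
by rewrite !scale_kmap mulrA.
Qed.

Definition long_paths n : set kQ :=
  [set f : kQ | forall p, kcoef p f != 0 -> (n <= path_length p)%N]%classic.

Lemma long_paths0 n : long_paths n 0.
Proof. by move=> p; rewrite kcoef0 eqxx. Qed.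
Lemma long_pathsD n f g : long_paths n f -> long_paths n g -> long_paths n (f + g).
Proof.
move=> nf ng p; rewrite kcoefD; have [->|/nf //] := eqVneq (kcoef p f) 0.
by rewrite add0r => /ng.
Qed.
Lemma long_pathsM n n' f g : long_paths n f -> long_paths n' g -> long_paths (n + n') (f * g).
Proof.
move=> nf ng r /kcoefM_supp[p [q [pq -> /nf np /ng nq]]].
by rewrite /path_length path_cat_arrows // size_cat leq_add.
Qed.
Lemma long_pathsMl n f g : long_paths n g -> long_paths n (f * g).
Proof. by move=> ng; have := @long_pathsM 0%N n f g (fun _ _ => isT) ng. Qed.
Lemma long_pathsMr n f g : long_paths n g -> long_paths n (g * f).
Proof. by move=> ng; have := @long_pathsM n 0%N g f ng (fun _ _ => isT); rewrite addn0. Qed.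

Definition long_ideal n :=
  Ideal (@long_paths0 n) (@long_pathsD n) (@long_pathsMl n) (@long_pathsMr n).

(** Paths of length at least [n] span a two-sided ideal, which for [n = 1] contains
    the arrows. *)
Lemma ideal_exp_arrows_long n f : ideal_exp arrow_ideal n f -> long_paths n f.
Proof.
elim: n f => [|n IH] f //= [l [a [b [Ia [Jb ->]]]]].
have S0 := @long_paths0 n.+1; have SD := @long_pathsD n.+1.
apply: (big_ind (long_paths n.+1) S0 SD) => i _.
rewrite -addn1; apply: long_pathsM; first exact: IH.
have := Jb i (long_ideal 1); apply => g [c ->] p.
by rewrite kcoef_elt; case: (p =P _) => [->|]; rewrite ?eqxx.
Qed.

Variable Z : rel (arrow Q).

Lemma mon_ideal_elt p : ~~ normal Z p -> ideal_set (mon_ideal Z) (path_elt p : kQ).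
Proof.
move=> pN q qn; rewrite kcoef_elt; case: eqP => // qp.
by rewrite -qp qn in pN.
Qed.

Lemma mon_ideal_ind (K : kQ -> Prop) f : K 0 -> (forall c g h, K g -> K h -> K (c *: g + h)) ->
  (forall p, ~~ normal Z p -> K (path_elt p)) -> ideal_set (mon_ideal Z) f -> K f.
Proof.
move=> K0 KD Kp If; apply: (kcoef_ind K0 KD) => p pf; apply: Kp.
by apply: contra pf => /If ->.
Qed.

(** A path that is not normal contains a relation of length two; this yields both
    the generators of the ideal and its inclusion in the square of the arrow
    ideal. *)
Lemma not_normalP p : ~~ normal Z p -> exists p' b a q,
  [/\ path_src p' = tgt b, src b = tgt a, src a = path_tgt q, Z b a &
   p = path_cat (path_rcons (path_rcons p' b) a) q].
Proof.
elim/(@qpath_rcons_ind Q): p => [//|p c pc IH] pN.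
have [pn|] := boolP (normal Z p); last first.
  move=> /IH[p' [b [a [q [pb ba aq ba' pE]]]]].
  have ps : path_src q = tgt c.
    by rewrite -pc pE path_cat_src // path_rcons_src // path_rcons_src.
  exists p', b, a, (path_rcons q c); split=> //; first by rewrite path_rcons_tgt.
  rewrite /path_rcons -/(path_rcons p' b) -/(path_rcons (path_rcons p' b) a).
  by rewrite pE path_catA // path_rcons_src // path_rcons_src.
have [[i pE]|[p' [b [pb pE]]]] := path_lastP p.
  by move: pN; rewrite /normal path_rcons_arrows // pE.
have bc : src b = tgt c by rewrite -pc pE path_rcons_src.
exists p', b, c, (vertex_path (src c)); split=> //.
  by move: pN; rewrite pE normal_rcons2 // -pE pn /= negbK.
have cs : path_src (path_rcons (path_rcons p' b) c) = src c by rewrite !path_rcons_src.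
by rewrite -cs path_catp1 pE.
Qed.

Lemma mon_ideal_gen : gen_by_paths_le 3 (mon_ideal Z : ideal kQ).
Proof.
exists [set p : qpath Q | ~~ normal Z p /\ (path_length p <= 2)%N]%classic.
  by move=> p [_ /leqW].
split=> [f If J SJ|f]; last first.
  by move=> /(_ (mon_ideal Z)); apply=> g [p [pN _] ->]; apply: mon_ideal_elt.
apply: (@mon_ideal_ind (fun f => ideal_set J f) f) If => [|c g h Jg Jh|p].
- exact: ideal0.
- by apply: idealD => //; rewrite scale_kmap; apply: Defs.idealMl.
move=> /not_normalP[p' [b [a [q [pb ba aq bZa ->]]]]].
rewrite path_elt_cat; last by rewrite path_rcons_src // path_rcons_src.
apply: Defs.idealMr.
have bs : path_src (arrow_path b) = tgt a by [].
have -> : path_rcons (path_rcons p' b) a = path_cat p' (path_rcons (arrow_path b) a).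
  by rewrite /path_rcons path_catA.
rewrite path_elt_cat ?path_rcons_tgt //; apply/Defs.idealMl/SJ.
exists (path_rcons (arrow_path b) a) => //; split.
  by rewrite /normal path_rcons_arrows //= bZa.
by rewrite path_rcons_length.
Qed.

Lemma mon_ideal_admissible N : (forall p, normal Z p -> (path_length p <= N)%N) ->
  admissible (mon_ideal Z : ideal kQ).
Proof.
move=> normal_length; split.
  exists N.+1 => // f /ideal_exp_arrows_long fN p /normal_length pN.
  apply/eqP/negPn/negP => /fN; rewrite ltnNge pN; exact.
move=> f If; pose J : set kQ := ideal_exp arrow_ideal 2.
have JZ c g : J g -> J (c *: g) by apply: ideal_mulZ => h; apply: ideal_mulZ.
have arI a : arrow_ideal (path_elt (arrow_path a) : kQ) by apply: ideal_gen_sub; exists a.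
apply: (@mon_ideal_ind J f) If => [|c g h Jg Jh|p].
- by exists 0%N, (fun=> 0), (fun=> 0); split=> [[]//|]; split=> [[]//|]; rewrite big_ord0.
- by apply: ideal_mulD => //; apply: JZ.
move=> /not_normalP[p' [b [a [q [pb ba aq bZa ->]]]]].
have as' : path_src (path_rcons (path_rcons p' b) a) = path_tgt q.
  by rewrite path_rcons_src // path_rcons_src.
have -> : path_cat (path_rcons (path_rcons p' b) a) q =
          path_cat (path_rcons p' b) (path_cat (arrow_path a) q).
  by rewrite path_catA // path_rcons_src.
rewrite path_elt_cat; last by rewrite path_cat_tgt // path_rcons_src.
apply: ideal_mul_elt; last first.
  by move=> I SI; rewrite path_elt_cat //; apply: Defs.idealMr; apply: (arI a I SI).
rewrite path_elt_cat //; apply: ideal_mul_elt => //.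
Qed.

End IdealArithmetic.

(** * Relations defined by a labelling of the vertices *)
Section LabelledRelations.
Context {k : fieldType} {Q : quiver} (Qnl : no_loops Q).
Variable lab : vertex Q -> 'I_#|vertex Q|.
Hypothesis lab_bij : bijective lab.
Variable E : rel (arrow Q).
Let labn v : nat := lab v.
Local Notation up := (goes_up labn).
Local Notation down := (goes_down labn).
Implicit Types (a b : arrow Q).

(** [E] holds the relations chosen among the pairs of arrows going up. *)
Definition label_rel b a := (src b == tgt a) && (up a && (down b || E b a)).
Local Notation Z := label_rel.

Lemma label_rel_comp b a : Z b a -> src b = tgt a.
Proof. by case/andP => /eqP. Qed.

Lemma label_rel_up b a : Z b a -> up a.
Proof. by case/and3P. Qed.

Lemma label_rel_down b a : src b = tgt a -> up a -> down b -> Z b a.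
Proof. by rewrite /label_rel => -> -> ->; rewrite eqxx. Qed.

Lemma label_up_or_down a : up a || down a.
Proof.
rewrite /goes_up /goes_down -neq_ltn; apply/eqP => /val_inj/(bij_inj lab_bij).
exact: Qnl.
Qed.

Let down_not_up a : down a -> up a = false.
Proof. by rewrite /goes_up /goes_down => da; apply/negbTE; rewrite -leqNgt ltnW. Qed.

(** A normal path goes down and then up, and each half visits a vertex at most
    once.  By induction from its end [v], the length is at most [n + labn v], and at
    most [n - labn v] if the path only goes down. *)
Lemma label_normal_length (p : qpath Q) : normal Z p -> path_length p <= #|vertex Q|.*2.
Proof.
pose n := #|vertex Q|; have labP v : labn v < n := ltn_ord (lab v).
suff H v s : is_path v s -> sorted (fun b a => ~~ Z b a) s ->
    (size s <= n + labn v) /\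
    ((if s is a :: _ then down a else true) -> size s + labn v <= n).
  move=> pn; have [+ _] := H _ _ (valP p) pn.
  by move/leq_trans; apply; rewrite -addnn leq_add2l ltnW.
elim: s v => [|a s IH] v /=; first by move=> _ _; split=> // _; rewrite add0n ltnW.
move=> /andP[/eqP <- ps] sn; have [sz dsz] := IH _ ps (path_sorted sn).
have down_bound : down a -> size s + labn (src a) <= n.
  move=> da; apply: dsz; case: s sn ps {sz IH} => //= b s /andP[abN _] /andP[/eqP ab _].
  case/orP: (label_up_or_down b) => // ub.
  by rewrite (label_rel_down (esym ab) ub da) in abN.
have dn : down a -> (size s).+1 + labn (tgt a) <= n.
  move=> da; apply: leq_trans (down_bound da).
  by rewrite addSnnS leq_add2l.
split=> //; case/orP: (label_up_or_down a) => [ua|da].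
  by apply: leq_ltn_trans sz _; rewrite ltn_add2l.
by apply: leq_trans (leq_addr _ _) (leq_trans (dn da) (leq_addr _ _)).
Qed.

(** In a relation chain only the last arrow can go down. *)
Lemma label_rel_chain d : (forall s, sorted E s -> size s <= d.+1) ->
  forall s, sorted Z s -> size s <= d.+2.
Proof.
move=> Ed; have upE b s : up b -> sorted Z (b :: s) -> sorted E (b :: s).
  elim: s b => //= a s IH b ub /andP[ba sZ].
  have /and3P[_ ua /orP[/down_not_up|Eba]] := ba; first by rewrite ub.
  by rewrite Eba; apply: IH.
case=> [|b [|a s]] // sZ; have /andP[ba aZ] := sZ.
by have := Ed _ (upE _ _ (label_rel_up ba) aZ).
Qed.

Local Notation I := (mon_ideal Z : ideal (path_algebra k Q)).
Let B : monomial_basis Z (quot_alg I) := mon_basis Z.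

Lemma label_sqh : strongly_quasi_hereditary I.
Proof.
have NL := label_normal_length; have ZC := label_rel_comp.
exists lab => // i.
have proj_at j : is_projective_at j (proj_mod B j).
  split; first exact: (proj_mod_fin_dim B NL).
  exists (simple_mod B j), (quot_map (rad_proj B j)); split.
    exact: (simple_modP B NL).
  exact: (proj_mod_cover B NL).
exists (submod_type (std_kernel B labn i)), (proj_mod B i), (std_mod B labn i).
exists (submod_incl _), (quot_map _); split=> //.
- exact: quot_short_exact.
- exists #|down_from labn i|, (fun l => tgt (enum_val l)), (fun l => proj_mod B (tgt (enum_val l))).
  split=> [l|].
    split; last exact: proj_at.
    move: (enum_val l) (enum_valP l : down_from labn i (enum_val l)) => a.
    by case/andP=> /eqP <-.
  exact: (std_kernel_direct_sum B NL ZC label_rel_up).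
move=> j S [v [v0 _ vj _]].
move=> cf.
exact: (@std_rad_composition_factor _ _ _ _ B _ NL labn
  label_up_or_down label_rel_down i j S v v0 vj cf).
Qed.

Lemma label_ideal : [/\ admissible I, gen_by_paths_le 3 I & strongly_quasi_hereditary I].
Proof.
split; [exact: mon_ideal_admissible label_normal_length|exact: mon_ideal_gen|].
exact: label_sqh.
Qed.

Lemma label_gldim_le d : (forall s, sorted E s -> size s <= d.+1) ->
  gldim_le (quot_alg I) d.+2.
Proof.
move=> /label_rel_chain; apply: (gldim_le_relation_chains B label_normal_length).
exact: label_rel_comp.
Qed.

Lemma label_gldim_ge n a c : 0 < size c -> path (fun a b => Z b a) a c ->
  gldim_le (quot_alg I) n -> size c < n.
Proof. exact: (gldim_ge_relation_chain B label_normal_length label_rel_comp). Qed.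

End LabelledRelations.

(** * Chains of arrows through the largest labels *)
(** Number the elements outside of [s] first, and then [s] in its order. *)
Lemma labelling_exists (V : finType) (s : seq V) : uniq s ->
  exists lab : V -> 'I_#|V|, [/\ bijective lab,
    forall x y, x \in s -> y \in s -> index x s < index y s -> lab x < lab y
    & forall x y, x \notin s -> y \in s -> lab x < lab y].
Proof.
move=> us; pose l := [seq x <- enum V | x \notin s] ++ s.
have inF x : (x \in [seq x <- enum V | x \notin s]) = (x \notin s).
  by rewrite mem_filter mem_enum andbT.
have lV x : x \in l by rewrite mem_cat inF orNb.
have ul : uniq l.
  rewrite cat_uniq filter_uniq ?enum_uniq // us andbT; apply/hasPn => x xs.
  by rewrite inF xs.
have sl : size l = #|V| by rewrite -(card_uniqP ul); apply: eq_card.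
have ltl x : index x l < #|V| by rewrite -sl index_mem.
exists (fun x => Ordinal (ltl x)); split=> /=.
- by apply: inj_card_bij; rewrite ?card_ord // => x y [/index_inj->].
- by move=> x y xs ys; rewrite !index_cat !inF xs ys ltn_add2l.
move=> x y xs ys; rewrite !index_cat !inF xs ys.
by apply: leq_trans (leq_addr _ _); rewrite index_mem inF.
Qed.

Section ChainIdeal.
Context {k : fieldType} {Q : quiver} (Qnl : no_loops Q).
Variables (d : nat) (v : nat -> vertex Q) (a : nat -> arrow Q).
Hypothesis v_inj : forall i j, i <= d.+1 -> j <= d.+1 -> v i = v j -> i = j.
Hypothesis a_src : forall j, j <= d.+1 -> src (a j) = v j.
Hypothesis a_tgt : forall j, j <= d -> tgt (a j) = v j.+1.

Let E (b c : arrow Q) := has (fun j => (c == a j) && (b == a j.+1)) (iota 0 d).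

(** The relations of [E] step from [a j] to [a j.+1], where [j < d], and the [a j]
    are distinct. *)
Lemma chain_sorted s : sorted E s -> size s <= d.+1.
Proof.
suff H b s' : sorted E (b :: s') -> s' = [::] \/ exists2 j, j <= d & b = a j /\ size s' <= j.
  case: s => // b s' /H[->//|[j jd [_ sj]]].
  by rewrite ltnS (leq_trans sj).
elim: s' b => [|c s' IH] b; first by left.
move=> /= /andP[/hasP[j]]; rewrite mem_iota add0n => /andP[_ jd] /andP[/eqP cj /eqP bj].
move=> /IH[->|[j' j'd [cj' sj']]]; right; exists j.+1 => //; split=> //.
rewrite /= ltnS (_ : j = j') //; apply: v_inj; try by rewrite leqW // ltnW.
by rewrite -!a_src ?leqW // ?(ltnW jd) // -cj -cj'.
Qed.

(** There are [d.+2] vertices [v 0, ..., v d.+1], joined by [a 0, ..., a d]; the arrow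
    [a d.+1] leaves the last one, whose label is the largest, and so goes down. *)
Lemma chain_ideal : exists I : ideal (path_algebra k Q),
  [/\ admissible I, gldim_eq (quot_alg I) d.+2, gen_by_paths_le 3 I
    & strongly_quasi_hereditary I].
Proof.
pose vs := [seq v j | j <- iota 0 d.+2].
have nth_vs j : j <= d.+1 -> nth (v 0) vs j = v j.
  by move=> jd; rewrite (nth_map 0) ?size_iota // nth_iota.
have uvs : uniq vs.
  rewrite map_inj_in_uniq ?iota_uniq // => i j; rewrite !mem_iota !add0n => /= id' jd'.
  exact: v_inj.
have vvs j : j <= d.+1 -> v j \in vs.
  by move=> jd; apply: map_f; rewrite mem_iota.
have ivs j : j <= d.+1 -> index (v j) vs = j.
  by move=> jd; rewrite -{1}(nth_vs j jd) index_uniq // size_map size_iota.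
have [lab [lab_bij lab_in lab_out]] := labelling_exists uvs.
have [I1 I2 I3] := label_ideal (k := k) Qnl lab_bij E.
exists (mon_ideal (label_rel lab E)); split=> //; split.
  exact: (label_gldim_le Qnl lab_bij chain_sorted).
move=> n; have sz : size [seq a j | j <- iota 1 d.+1] = d.+1 by rewrite size_map size_iota.
rewrite -[d.+2]/(d.+1.+1) -{1}sz; apply: (label_gldim_ge (a := a 0) Qnl lab_bij); rewrite ?sz //.
apply/(pathP (a 0)) => j; rewrite sz => jd.
have -> : nth (a 0) [seq a j | j <- iota 1 d.+1] j = a j.+1.
  by rewrite (nth_map 0) ?size_iota // nth_iota.
have -> : nth (a 0) (a 0 :: [seq a j | j <- iota 1 d.+1]) j = a j.
  have jd2 : j < d.+2 by apply: leqW.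
  by rewrite -[_ :: _]/[seq a j | j <- iota 0 d.+2] (nth_map 0) ?size_iota // nth_iota.
rewrite /label_rel a_src // a_tgt // eqxx /=.
have -> : goes_up (fun v => lab v) (a j).
  have jd1 : j <= d.+1 by apply: ltnW.
  rewrite /goes_up a_src // a_tgt //; apply: (lab_in); [exact: vvs|exact: vvs|].
  by rewrite !ivs.
rewrite andTb; move: jd; rewrite ltnS leq_eqVlt => /orP[/eqP->|jd]; last first.
  by apply/orP; right; apply/hasP; exists j; rewrite ?eqxx // mem_iota.
apply/orP; left; rewrite /goes_down a_src //.
have [tvs|tvs] := boolP (tgt (a d.+1) \in vs); last exact: lab_out (vvs _ _).
apply: lab_in => //; rewrite ?vvs // ivs //.
have := tvs; rewrite -index_mem size_map size_iota ltnS leq_eqVlt => /orP[/eqP td|//].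
by case: (@Qnl (a d.+1)); rewrite a_src // -(nth_index (v 0) tvs) td nth_vs.
Qed.

End ChainIdeal.

Theorem theorem1 (k : fieldType) (Q : quiver) (Qnl : no_loops Q) :
  (exists I : ideal (path_algebra k Q),
     [/\ admissible I, gldim_le (quot_alg I) 2,
         gen_by_paths_le 3 I & strongly_quasi_hereditary I])
  /\
  (forall d m : nat, 2 <= d -> d < m -> subquiver (quiverA m) Q ->
   exists I' : ideal (path_algebra k Q),
     [/\ admissible I', gldim_eq (quot_alg I') d,
         gen_by_paths_le 3 I' & strongly_quasi_hereditary I'])
  /\
  (forall d m : nat, 2 <= d -> d <= m ->
   (exists i : 'I_m.-1, subquiver (quiverX i) Q) ->
   exists I' : ideal (path_algebra k Q),
     [/\ admissible I', gldim_eq (quot_alg I') d,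
         gen_by_paths_le 3 I' & strongly_quasi_hereditary I']).
Proof.
split; [|split].
- have lab_bij : bijective (@enum_rank (vertex Q)).
    by exists enum_val; [apply: enum_rankK|apply: enum_valK].
  have [I1 I2 I3] := label_ideal (k := k) Qnl lab_bij (fun _ _ => false).
  exists (mon_ideal (label_rel (@enum_rank (vertex Q)) (fun _ _ => false))); split=> //.
  by apply: (label_gldim_le (d := 0) Qnl lab_bij) => -[|b [|c s]].
- move=> [|[|d]] [|[|m]] // _ dm [fv [fa [vI _ sE tE]]].
  have arP j : j <= d.+1 -> j < m.+1 by move=> jd; exact: leq_ltn_trans jd (dm : d.+1 < m.+1).
  apply: (@chain_ideal k Q Qnl d (fun j => fv (inord j)) (fun j => fa (inord j))).
  + move=> i j /arP/ltnW im /arP/ltnW jm /vI/(congr1 val) /=.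
    by rewrite !inordK.
  + move=> j /arP jm; rewrite sE; congr (fv _); apply: val_inj.
    by rewrite /= !inordK // ltnW.
  + move=> j jd; have jm := arP j (leqW jd).
    rewrite tE; congr (fv _); apply: val_inj.
    by rewrite /= !inordK.
move=> [|[|d]] [|[|m]] // _ dm [i [fv [fa [vI _ sE tE]]]].
have vP j : j <= d.+1 -> j < m.+2 by move=> jd; exact: leq_trans (jd : j < d.+2) dm.
(* The additional arrow of the quiver is the last one of the chain if [d = m]. *)
pose ar j := fa (if j <= m then Some (inord j) else None).
apply: (@chain_ideal k Q Qnl d (fun j => fv (inord j)) ar).
- move=> i' j /vP im /vP jm /vI/(congr1 val) /=.
  by rewrite !inordK.
- move=> j /vP jm2; rewrite /ar; case: leqP => jm; rewrite sE; congr (fv _); apply: val_inj.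
    by rewrite /= !inordK.
  by rewrite /= inordK //; apply/eqP; rewrite eqn_leq jm -ltnS.
move=> j jd; have jm : j < m.+1 := vP j.+1 jd.
rewrite /ar -ltnS jm tE; congr (fv _); apply: val_inj.
by rewrite /= !inordK.
Qed.
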